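(* For cluster algebras of type $A_n$: (i) the denominator fan associated to any triangulation $T$ of a convex $(n+3)$-gon is a complete simplicial fan, and (ii) it is the normal fan of a polytope, namely of the Santos associahedron $\mathrm{Ass}^{\mathrm{II}}_n(T)$.
   Context: **Denominator fan.** In a cluster algebra of type $A_n$ the cluster variables $x_\gamma$ are in the standard bijection with the internal diagonals $\gamma$ of a convex $(n+3)$-gon, so that clusters correspond to triangulations (sets of $n$ pairwise non-crossing diagonals) and mutations to flips. Fix a triangulation $T=\{\delta_1,\dots,\delta_n\}$, i.e. a seed cluster $(x_{\delta_1},\dots,x_{\delta_n})$. Every cluster variable is a Laurent polynomial in the seed cluster, $x_\gamma=N_\gamma/(x_{\delta_1}^{d_1}\cdots x_{\delta_n}^{d_n})$ with $d_i\in\mathbb Z$ and $N_\gamma$ a polynomial in $x_{\delta_1},\dots,x_{\delta_n}$ not divisible by any $x_{\delta_i}$; the denominator vector of $x_\gamma$ with respect to $T$ is $\sum_i d_i\alpha_i$, where $\alpha_1,\dots,\alpha_n$ is a basis of an $n$-dimensional real vector space $V$ (so $x_{\delta_i}$ has denominator vector $-\alpha_i$). The denominator fan associated to $T$ is the collection of cones in $V$ whose rays are spanned by the denominator vectors of the cluster variables with respect to $T$, and whose maximal cones are spanned by the denominator vectors of the variables in each cluster (a priori it is not assumed to be a fan). **Santos associahedron.** Two diagonals cross if they meet in a point interior to both. For the triangulation $T=\{\delta_1,\dots,\delta_n\}$ and the basis $\alpha_1,\dots,\alpha_n$ of $V$, associate to each diagonal $pq$ the vector $v_{pq}=-\alpha_i$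 if $pq=\delta_i$, and $v_{pq}=\sum_{i:\ pq\text{ crosses }\delta_i}\alpha_i$ if $pq\notin T$. The cones generated by $\{v_\delta:\delta\in T'\}$, for all triangulations $T'$ of the $(n+3)$-gon, are the maximal cones of a complete simplicial fan $\mathcal F_T$ in $V$, which is the normal fan of a polytope; $\mathrm{Ass}^{\mathrm{II}}_n(T)$ denotes any polytope with normal fan $\mathcal F_T$. *)

(* Defs.v *)
From mathcomp Require Import all_boot all_order all_algebra.
From mathcomp Require Import boolp classical_sets cardinality reals.
From mathcomp Require Import mpoly.

Set Implicit Arguments.
Unset Strict Implicit.
Unset Printing Implicit Defensive.

Import Order.TTheory GRing.Theory Num.Theory.
Local Open Scope ring_scope.

(** * Polyhedral cones, fans and polytopes in R^n

    The dual of R^n is identified with R^n through [dot]. *)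

Section Polyhedra.
Variables (R : realType) (n : nat).
Local Notation V := 'rV[R]_n.

Definition dot (u v : V) : R := \sum_(i < n) u 0 i * v 0 i.

Definition cone (I : finType) (g : I -> V) (S : pred I) : set V :=
  [set x | exists c : I -> R,
     (forall i, 0 <= c i) /\ x = \sum_(i | S i) c i *: g i]%classic.

Definition polyhedral_cone (C : set V) : Prop :=
  exists (m : nat) (g : 'I_m -> V), C = cone g predT.

Definition simplicial_cone (C : set V) : Prop :=
  exists (m : nat) (g : 'I_m -> V),
    row_free (\matrix_(i < m) g i) /\ C = cone g predT.

(* Taking [u := 0], [C] is a face of itself. *)
Definition is_face (F C : set V) : Prop :=
  exists u : V, (forall x, C x -> 0 <= dot u x) /\
    F = [set x | C x /\ dot u x = 0]%classic.

Definition is_fan (Sigma : set (set V)) : Prop :=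
  [/\ finite_set Sigma,
      (forall C, Sigma C -> polyhedral_cone C),
      (forall C F, Sigma C -> is_face F C -> Sigma F) &
      (forall C D, Sigma C -> Sigma D ->
         is_face (C `&` D)%classic C /\ is_face (C `&` D)%classic D)].

Definition complete_simplicial_fan (Sigma : set (set V)) : Prop :=
  [/\ is_fan Sigma,
      (forall x, exists C, Sigma C /\ C x) &
      (forall C, Sigma C -> simplicial_cone C)].

Definition is_polytope (Q : set V) : Prop :=
  exists (m : nat) (p : 'I_m.+1 -> V),
    Q = [set x | exists c : 'I_m.+1 -> R,
           [/\ forall i, 0 <= c i, \sum_i c i = 1 & x = \sum_i c i *: p i]]%classic.

Definition max_face (Q : set V) (c : V) : set V :=
  [set x | Q x /\ forall y, Q y -> dot c y <= dot c x]%classic.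

(* The nonempty faces of a polytope are the sets [max_face Q u]; the normal
   cone of such a face consists of the functionals maximized on all of it. *)
Definition normal_fan (Q : set V) : set (set V) :=
  [set N | exists u : V,
     N = [set c | (max_face Q u `<=` max_face Q c)%classic]%classic]%classic.

End Polyhedra.

(** * Triangulations of the convex (n+3)-gon

    The vertices are labelled by ['I_n.+3] in counterclockwise order, and the
    segment joining [p] and [q] is the two-element set [[set p; q]]. *)

Section Polygon.
Variables (R : realType) (n : nat).
Local Notation vertex := 'I_n.+3.

(* Twice the signed area of the triangle [abc]. *)
Definition orient (a b c : 'rV[R]_2) : R :=
  (b 0 0 - a 0 0) * (c 0 1 - a 0 1) - (b 0 1 - a 0 1) * (c 0 0 - a 0 0).

Definition convex_polygon (P : vertex -> 'rV[R]_2) : Prop :=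
  forall i j k : vertex, (i < j)%N -> (j < k)%N -> 0 < orient (P i) (P j) (P k).

Definition is_side (d : {set vertex}) : bool :=
  [exists p : vertex, d == [set p; ordS p]].

Definition is_diagonal (d : {set vertex}) : bool :=
  [exists p : vertex, exists q : vertex,
     [&& p != q, d == [set p; q] & ~~ is_side d]].

Definition in_interior (P : vertex -> 'rV[R]_2) (d : {set vertex})
    (y : 'rV[R]_2) : Prop :=
  exists p q : vertex, [/\ p != q, d = [set p; q] &
    exists a : R, [/\ 0 < a, a < 1 & y = (1 - a) *: P p + a *: P q]].

Definition crosses (P : vertex -> 'rV[R]_2) (d e : {set vertex}) : Prop :=
  d <> e /\ exists y, in_interior P d y /\ in_interior P e y.

Definition triangulation (P : vertex -> 'rV[R]_2) (T : 'I_n -> {set vertex}) :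
    Prop :=
  [/\ forall i, is_diagonal (T i), injective T &
      forall i j, ~ crosses P (T i) (T j)].

End Polygon.

(** * The Santos associahedron *)

Section Santos.
Variables (R : realType) (n : nat) (P : 'I_n.+3 -> 'rV[R]_2).
Variable T : 'I_n -> {set 'I_n.+3}.

(* The basis vector alpha_i is [delta_mx 0 i]. *)
Definition santos_vector (d : {set 'I_n.+3}) : 'rV[R]_n :=
  if [pick i | T i == d] is Some i then - delta_mx 0 i
  else \sum_(i < n | `[< crosses P d (T i) >]) delta_mx 0 i.

Definition santos_fan : set (set 'rV[R]_n) :=
  [set C | exists T' : 'I_n -> {set 'I_n.+3}, triangulation P T' /\
     is_face C (cone (fun j => santos_vector (T' j)) predT)]%classic.

Definition santos_associahedron (Q : set 'rV[R]_n) : Prop :=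
  is_polytope Q /\ normal_fan Q = santos_fan.

End Santos.

(** * The cluster algebra with initial seed given by a triangulation *)

Section Cluster.
Variable n : nat.

(* The ambient field Q(x_1, ..., x_n), as the fraction field of Z[x_1, ..., x_n]. *)
Definition ambient := {fraction {mpoly int[n]}}.

Record seed := Seed { cluster : 'I_n -> ambient; exchange : 'M[int]_n }.

Definition pos_part (z : int) : nat := `|Num.max z 0|%N.

Definition mutate (s : seed) (k : 'I_n) : seed :=
  let x := cluster s in let B := exchange s in
  Seed
    (fun i => if i == k then
                (\prod_(j < n) x j ^+ pos_part (B j k)
                 + \prod_(j < n) x j ^+ pos_part (- B j k)) / x k
              else x i)
    (\matrix_(i, j)
       if (i == k) || (j == k) then - B i j
       else B i j + (pos_part (B i k))%:Z * (pos_part (B k j))%:Z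
                  - (pos_part (- B i k))%:Z * (pos_part (- B k j))%:Z).

Section InitialSeed.
Variable T : 'I_n -> {set 'I_n.+3}.

(* In a convex polygon, a triple of vertices pairwise joined by sides or by
   diagonals of [T] is a triangle of [T]; [p < q < r] is counterclockwise. *)
Definition is_triangle (p q r : 'I_n.+3) : bool :=
  let edge d := is_side d || [exists i, T i == d] in
  [&& (p < q)%N, (q < r)%N,
      edge [set p; q], edge [set q; r] & edge [set r; p]].

(* Along the boundary of the triangle [pqr], the side [T j] comes immediately
   after the side [T i] in counterclockwise order. *)
Definition ccw_next (p q r : 'I_n.+3) (i j : 'I_n) : bool :=
  [|| (T i == [set p; q]) && (T j == [set q; r]),
      (T i == [set q; r]) && (T j == [set r; p]) |
      (T i == [set r; p]) && (T j == [set p; q])].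

(* The signed adjacency matrix of [T]: each triangle contributes 1 to the
   (i, j) entry if [T j] follows [T i] clockwise, and -1 if counterclockwise. *)
Definition adjacency : 'M[int]_n :=
  \matrix_(i, j) \sum_(p < n.+3) \sum_(q < n.+3) \sum_(r < n.+3 | is_triangle p q r)
     ((ccw_next p q r j i : nat)%:Z - (ccw_next p q r i j : nat)%:Z).

Definition initial_seed : seed :=
  Seed (fun i => tofrac ('X_i : {mpoly int[n]})) adjacency.

Definition seed_at (ks : seq 'I_n) : seed := foldl mutate initial_seed ks.

End InitialSeed.

Definition denominator_vector (z : ambient) (d : 'I_n -> int) : Prop :=
  exists N : {mpoly int[n]},
    (forall i, ~ exists q : {mpoly int[n]}, N = 'X_i * q) /\
    z = tofrac N / \prod_(i < n) tofrac ('X_i : {mpoly int[n]}) ^ d i.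

(* No linear independence is assumed of the denominator vectors: the collection
   consists of the cones spanned by the denominator vectors of the subsets [S]
   of the clusters. *)
Definition denominator_fan (R : realType) (T : 'I_n -> {set 'I_n.+3}) :
    set (set 'rV[R]_n) :=
  [set C | exists (ks : seq 'I_n) (d : 'I_n -> 'I_n -> int) (S : pred 'I_n),
     (forall j, denominator_vector (cluster (seed_at T ks) j) (d j)) /\
     C = cone (fun j => \row_i (d j i)%:~R) S]%classic.

End Cluster.

Arguments denominator_fan {n} R T _.

(* Main.v *)
(* Both fans consist of the cones over the sets of pairwise non-crossing
   diagonals, spanned by the same vectors v(d) of signed crossing numbers with T.

   Cluster side.  Chords get values x(pq) = det(u_p, u_q) for vectors u_p of the
   plane chosen, triangle by triangle, so that the sides have value 1 and the
   diagonals of T the initial variables; the Pluecker relations are then the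
   exchange relations, flips realize mutations, and any triangulation is reached
   since all of them flip to the star of vertex 0.  If ab in T crosses pq, then
   x(pq) = (x(pa) x(qb) + x(aq) x(bp)) / x(ab), where the four chords cross fewer
   diagonals of T; as the numerators are positive when one variable is set to 0
   and the others to 1, denominators obey the tropical version of this formula,
   which is also the one obeyed by crossing numbers.

   Polyhedral side.  For each quadrilateral abcd, v(ac) and v(bd) satisfy a
   dependence x v(ac) + y v(bd) = (nonnegative combination of the sides), which
   fails with a strict inequality for suitable heights w(d).  By induction on
   the number of crossings, the v(d) with d in a triangulation T' form a basis,
   and the point y(T') with <y(T'), v(d)> = w(d) for d in T' satisfies
   <y(T'), v(d)> < w(d) for all other diagonals d.  A vector z lies in the cone of
   the T' maximizing <y(T'), z>, since flipping a diagonal with a negative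
   coefficient would increase this value; hence the cones form the normal fan of
   the convex hull of the points y(T'). *)

Require Import Defs.
From mathcomp Require Import all_boot all_order all_algebra.
From mathcomp Require Import boolp classical_sets cardinality reals.
From mathcomp Require Import mpoly zify ring lra.
(* Imported again, so as to shadow the homonyms in classical_sets. *)
From mathcomp Require Import fintype finset.

Set Implicit Arguments.
Unset Strict Implicit.
Unset Printing Implicit Defensive.

Import Order.TTheory GRing.Theory Num.Theory.

(** * Crossing chords, by position of their end points *)

Definition inarc (p q r : nat) : bool := (p < r < q) || (q < r < p).

Definition crossn (p q r s : nat) : bool :=
  [&& r != p, r != q, s != p, s != q & inarc p q r != inarc p q s].

Definition eqp (p q r s : nat) : bool :=
  ((r == p) && (s == q)) || ((r == q) && (s == p)).

Definition cyc4 (a b c d : nat) : bool :=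
  [|| (a < b < c) && (c < d), (b < c < d) && (d < a),
      (c < d < a) && (a < b) | (d < a < b) && (b < c)].

(** The coordinate of the vector of the chord [pq] along the basis vector attached to the diagonal
    [rs]. *)
Definition chin (p q r s : nat) : int :=
  if eqp p q r s then (-1)%R else Posz (crossn p q r s).

(* Everything that is asserted below about chords relative to a quadrilateral
   [a < b < c < d] only depends on the position of their endpoints among the
   nine classes cut out by [a], [b], [c], [d] on the line; the assertions are
   then checked by computation on the labels [0, ..., 8]. *)
Definition pos (a b c d r : nat) : nat :=
  if r < a then 0 else if r == a then 1 else if r < b then 2 else
  if r == b then 3 else if r < c then 4 else if r == c then 5 else
  if r < d then 6 else if r == d then 7 else 8.

Section Position.
Variables a b c d : nat.
Hypothesis abcd : (a < b < c) && (c < d).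
Local Notation ps := (pos a b c d).

Lemma pos_lt9 r : ps r < 9.
Proof using abcd. by rewrite /pos; repeat case: ifP => // _. Qed.

Lemma pos_mono r s : ps r < ps s -> r < s.
Proof. by move: abcd; rewrite /pos; do ![case: ifP]; lia. Qed.

Lemma pos_a r : ((r < a) = (ps r < 1)) * ((a < r) = (1 < ps r))
   * ((r == a) = (ps r == 1)).
Proof. by move: abcd; rewrite /pos => ?; split; [split|]; do ![case: ifP]; lia. Qed.

Lemma pos_b r : ((r < b) = (ps r < 3)) * ((b < r) = (3 < ps r))
   * ((r == b) = (ps r == 3)).
Proof. by move: abcd; rewrite /pos => ?; split; [split|]; do ![case: ifP]; lia. Qed.

Lemma pos_c r : ((r < c) = (ps r < 5)) * ((c < r) = (5 < ps r))
   * ((r == c) = (ps r == 5)).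
Proof. by move: abcd; rewrite /pos => ?; split; [split|]; do ![case: ifP]; lia. Qed.

Lemma pos_d r : ((r < d) = (ps r < 7)) * ((d < r) = (7 < ps r))
   * ((r == d) = (ps r == 7)).
Proof. by move: abcd; rewrite /pos => ?; split; [split|]; do ![case: ifP]; lia. Qed.

Lemma pos_self : (ps a = 1) * (ps b = 3) * (ps c = 5) * (ps d = 7).
Proof. by move: abcd; rewrite /pos; do !split; do ![case: ifP]; lia. Qed.

End Position.

Lemma all9 (P : rel nat) : all (fun x => all (P x) (iota 0 9)) (iota 0 9) ->
  forall x y, x < 9 -> y < 9 -> P x y.
Proof.
move/allP=> H x y lx ly; have in9 z : z < 9 -> z \in iota 0 9 by rewrite mem_iota.
by have /allP/(_ y (in9 y ly)) := H x (in9 x lx).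
Qed.

Ltac position H :=
  rewrite /chin /eqp /crossn /inarc;
  rewrite ?(pos_a H, pos_b H, pos_c H, pos_d H).

Ltac check9 H r s :=
  move: (pos _ _ _ _ r) (pos _ _ _ _ s) (pos_lt9 H r) (pos_lt9 H s);
  apply: all9; vm_compute.

(** Tropicalization of [x(ac) x(bd) = x(ab) x(cd) + x(bc) x(da)]: crossing numbers obey the rule by
    which denominators change under a flip. *)
Lemma tropical_ptolemy a b c d r s : cyc4 a b c d ->
  (chin a c r s + chin b d r s ==
   Num.max (chin a b r s + chin c d r s) (chin b c r s + chin d a r s))%R.
Proof. by case/or4P=> H; position H; check9 H r s. Qed.

Lemma all9_4 (P : nat -> nat -> rel nat) :
  all (fun x => all (fun y => all (fun z => all (P x y z) (iota 0 9))
    (iota 0 9)) (iota 0 9)) (iota 0 9) ->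
  forall x y z t, x < 9 -> y < 9 -> z < 9 -> t < 9 -> P x y z t.
Proof.
move=> H x y z t lx ly lz lt; apply: (all9 (P := P x y)) => //.
by apply: (all9 (P := fun x y => all (fun z => all (P x y z) (iota 0 9))
  (iota 0 9))).
Qed.

Lemma crossnC p q r s : crossn p q r s = crossn r s p q.
Proof. by rewrite /crossn /inarc; lia. Qed.

Lemma crossn_sym p q r s : crossn q p r s = crossn p q r s.
Proof. by rewrite /crossn /inarc; lia. Qed.

(** Merging labels into classes can destroy a crossing but not create one. In contrapositive form
    this carries non-crossing hypotheses over to the finite check. *)
Lemma crossn_pos a b c d p q r s : (a < b < c) && (c < d) ->
  crossn (pos a b c d p) (pos a b c d q) (pos a b c d r) (pos a b c d s) ->
  crossn p q r s.
Proof.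
move=> H; have M x y := @pos_mono a b c d H x y.
rewrite /crossn /inarc.
move: (M p q) (M p r) (M p s) (M q p) (M q r) (M q s) (M r p) (M r q).
move: (M s p) (M s q) => {M}; lia.
Qed.

(** For such [rs] the maximum in [tropical_cross] is attained at the pair [ab], [cd] alone. *)
Definition prefers a b c d r s : bool :=
  crossn b c r s + crossn d a r s < crossn a b r s + crossn c d r s.

(** Both diagonals end at [a]; the first leaves the quadrilateral through [cd], the second through
    [bc]. *)
Definition fan_at a b c d r s r' s' : bool :=
  [&& (r == a) || (s == a), (r' == a) || (s' == a), crossn c d r s &
      crossn b c r' s'].

(** A diagonal prefers a pair of opposite sides when it crosses both, or crosses one and ends at an
    end of the other. Opposite preferences make two diagonals cross unless they issue from the same
    vertex of the quadrilateral. *)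
Lemma prefers_conflict a b c d r s r' s' : cyc4 a b c d ->
  prefers a b c d r s -> prefers b c d a r' s' -> ~~ crossn r s r' s' ->
  [|| fan_at a b c d r s r' s', fan_at b c d a r' s' r s,
      fan_at c d a b r s r' s' | fan_at d a b c r' s' r s].
Proof.
by case/or4P=> H pi pj /(contra (@crossn_pos _ _ _ _ r s r' s' H)) nc;
  move: nc; apply/implyP; move: pj; apply/implyP; move: pi; apply/implyP;
  rewrite /fan_at /prefers; position H;
  move: (pos _ _ _ _ r) (pos _ _ _ _ s) (pos _ _ _ _ r') (pos _ _ _ _ s')
    (pos_lt9 H r) (pos_lt9 H s) (pos_lt9 H r') (pos_lt9 H s');
  apply: all9_4; vm_compute.
Qed.

(** A diagonal that crosses [ac] but neither [at] nor [at'] cuts off the corner [c]: it crosses [bc]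
    and [cd] and misses [bd], which forces the coefficient 2 of [ac]. For the diagonal [ac] itself
    the coefficient has to be 1. *)
Lemma fan_relation a b c d t t' x y : cyc4 a b c d ->
  crossn c d a t -> crossn b c a t' ->
  ~~ crossn x y a t -> ~~ crossn x y a t' ->
  (eqp a c x y || (chin a c x y *+ 2 + chin b d x y ==
      chin b c x y + chin c d x y)%R) &&
  (crossn a c x y || (chin a c x y + chin b d x y ==
      chin b c x y + chin c d x y)%R).
Proof.
by case/or4P=> H p1 p2;
  move=> /(contra (@crossn_pos _ _ _ _ _ _ _ _ H)) n1;
  move=> /(contra (@crossn_pos _ _ _ _ _ _ _ _ H)) n2; move: n2;
  apply/implyP; move: n1; apply/implyP; move: p2; apply/implyP; move: p1;
  apply/implyP; position H; rewrite !(pos_self H);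
  move: (pos _ _ _ _ t) (pos _ _ _ _ t') (pos _ _ _ _ x) (pos _ _ _ _ y)
    (pos_lt9 H t) (pos_lt9 H t') (pos_lt9 H x) (pos_lt9 H y);
  apply: all9_4; vm_compute.
Qed.

(** Unlike in [tropical_ptolemy], a side equal to [rs] counts 0 instead of -1, so that sides
    belonging to [T] can be left out of a dependence. *)
Lemma tropical_cross a b c d r s : cyc4 a b c d ->
  (chin a c r s + chin b d r s ==
   Posz (maxn (crossn a b r s + crossn c d r s)
              (crossn b c r s + crossn d a r s)))%R.
Proof. by case/or4P=> H; position H; check9 H r s. Qed.

Lemma quad_cross a b c d r s : cyc4 a b c d -> crossn b d r s ->
  [|| crossn a b r s, crossn b c r s, crossn c d r s, crossn d a r s |
      eqp a c r s].
Proof. by case/or4P=> H; apply/implyP; position H; check9 H r s. Qed.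

Definition cyc3 (a b c : nat) : bool := [|| a < b < c, b < c < a | c < a < b].

Lemma cross_triangle a b c r s : crossn b c r s -> ~~ crossn a c r s ->
  ~~ crossn a b r s -> (r == a) || (s == a).
Proof. by rewrite /crossn /inarc; lia. Qed.

Lemma crossn_symr p q r s : crossn p q s r = crossn p q r s.
Proof. by rewrite /crossn /inarc; lia. Qed.

Lemma crossnn p r s : crossn p p r s = false.
Proof. by rewrite /crossn /inarc; case: (ltngtP p r); case: (ltngtP p s). Qed.

Lemma cyc3_cyc4 a b c d : cyc3 a b c -> cyc3 c d a -> cyc4 a b c d.
Proof. by rewrite /cyc3 /cyc4; lia. Qed.

Lemma eqpC p q r s : eqp p q r s = eqp r s p q.
Proof. by rewrite /eqp; lia. Qed.

(** A chord that enters through a side without crossing [bd] cuts off [a] or [c], or ends at [b] or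
    [d]; in each case it separates [a] from [c]. *)
Lemma quad_subcross a b c d r s : cyc4 a b c d -> ~~ crossn b d r s ->
  [|| crossn a b r s, crossn b c r s, crossn c d r s | crossn d a r s] ->
  crossn a c r s.
Proof.
by case/or4P=> H; move=> X Y; move: Y; apply/implyP; move: X; apply/implyP;
  position H; check9 H r s.
Qed.

Lemma crossn_cyc4 p q a b : crossn p q a b -> cyc4 p a q b || cyc4 p b q a.
Proof. by rewrite /crossn /inarc /cyc4; lia. Qed.

(** If [x] lay strictly between [c] and [d], then [ax] would cross [cd]; if strictly between [d] and
    [a], then [cx] would cross [da]. *)
Lemma apex_unique a b c d x : cyc4 a b c d -> cyc3 a c x ->
  ~~ crossn a x c d -> ~~ crossn c x d a -> x = d.
Proof. by rewrite /cyc4 /cyc3 /crossn /inarc; case/or3P=> *; lia. Qed.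

(** * Non-crossing sets of diagonals *)

Section Apex.
Variable F : rel nat.
Hypothesis F_long : forall p q, F p q -> p.+1 < q.
Hypothesis F_nc : forall p q r s, F p q -> F r s -> ~~ crossn p q r s.

(** In a triangulation this is the third vertex of the triangle below [pq]. As [F] need not be
    maximal, it is taken to be the last neighbour of [p] before [q], where [p.+1] counts as a
    neighbour. *)
Definition apex (p q : nat) : nat := \max_(c < q | (c == p.+1 :> nat) || F p c) c.

Lemma apexP p q : F p q ->
  [/\ p < apex p q < q, (apex p q == p.+1) || F p (apex p q) &
      forall c, c < q -> F p c -> c <= apex p q].
Proof.
move=> Fpq; have lpq := F_long Fpq; rewrite /apex.
pose P := [pred c : 'I_q | (c == p.+1 :> nat) || F p c].
have P0 : P (Ordinal lpq) by rewrite /= eqxx.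
rewrite (bigop.bigmax_eq_arg _ P0); case: arg_maxnP => //= c Pc Hc; split=> //.
- by rewrite ltn_ord andbT; case/orP: Pc => [/eqP->//|/F_long/ltnW].
- by move=> e eq Fpe; apply: (Hc (Ordinal eq)); rewrite /= Fpe orbT.
Qed.

(* Two chords with the same apex [c] are nested around [c], and the chord from
   [p] to [c] of the outer one crosses the inner one. *)
Lemma apex_inj p q r s : F p q -> F r s -> apex p q = apex r s ->
  p = r /\ q = s.
Proof.
move=> Fpq Frs E; have [h1 h2 h3] := apexP Fpq; have [h4 h5 h6] := apexP Frs.
rewrite -E in h4 h5 h6; move: (apex p q) E h1 h2 h3 h4 h5 h6 => c _.
move=> h1 h2 h3 h4 h5 h6.
have hpr : p = r.
  case: (ltngtP p r) => // pr.
    case/orP: h2 => [|Fpc]; first lia.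
    by have := F_nc Fpc Frs; rewrite /crossn /inarc; lia.
  case/orP: h5 => [|Frc]; first lia.
  by have := F_nc Frc Fpq; rewrite /crossn /inarc; lia.
subst r; split=> //; case: (ltngtP q s) => // qs.
  by have := h6 q qs Fpq; lia.
by have := h3 s qs Frs; lia.
Qed.
End Apex.

Section Chords.
Variable n : nat.
Local Notation vertex := 'I_n.+3.
Implicit Types (p q r s : vertex) (d e : {set vertex}).

Lemma set2_eq p q r s : ([set p; q] == [set r; s]) = eqp p q r s.
Proof.
rewrite /eqp !(inj_eq val_inj); apply/eqP/orP; last first.
  by case=> /andP[/eqP-> /eqP->] //; rewrite setUC.
move=> E; have := set21 p q; have := set22 p q; have := set21 r s.
have := set22 r s; rewrite E -{1 2}E !in_set2 (eq_sym r p) (eq_sym r q).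
rewrite (eq_sym s p) (eq_sym s q).
by case: (p == r) (p == s) (q == r) (q == s) => -[] [] []; auto.
Qed.

Definition xing d e : bool :=
  [exists p, exists q, exists r, exists s,
     [&& d == [set p; q], e == [set r; s] & crossn p q r s]].

Lemma xingE p q r s : xing [set p; q] [set r; s] = crossn p q r s.
Proof.
apply/idP/idP => [/existsP[p' /existsP[q' /existsP[r' /existsP[s']]]]|H].
  rewrite !set2_eq /eqp /crossn /inarc => /and3P[]; lia.
apply/existsP; exists p; apply/existsP; exists q.
by apply/existsP; exists r; apply/existsP; exists s; rewrite !eqxx.
Qed.

Lemma xingC d e : xing d e = xing e d.
Proof.
suff H d' e' : xing d' e' -> xing e' d' by apply/idP/idP; apply: H.
case/existsP=> p /existsP[q /existsP[r /existsP[s /and3P[/eqP-> /eqP->]]]].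
by rewrite crossnC xingE.
Qed.

Definition siden (p q : nat) : bool :=
  [|| q == p.+1, p == q.+1, (p == 0) && (q == n.+2) | (q == 0) && (p == n.+2)].

Lemma is_sideE p q : is_side [set p; q] = siden p q.
Proof.
apply/existsP/idP => [[r]|].
  rewrite set2_eq /eqp /siden /=; have := ltn_ord r.
  rewrite ltnS leq_eqVlt => /orP[/eqP->|lr]; first by rewrite modnn; lia.
  by rewrite modn_small ?ltnS //; lia.
rewrite /siden => /or4P[/eqP H|/eqP H|/andP[/eqP H1 /eqP H2]|/andP[/eqP H1 /eqP H2]].
- exists p; apply/eqP; congr [set _; _]; apply: val_inj => /=.
  by rewrite modn_small; have := ltn_ord q; lia.
- exists q; rewrite setUC; apply/eqP; congr [set _; _]; apply: val_inj => /=.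
  by rewrite modn_small; have := ltn_ord p; lia.
- exists q; rewrite setUC; apply/eqP; congr [set _; _]; apply: val_inj => /=.
  by rewrite H2 modnn.
- exists p; apply/eqP; congr [set _; _]; apply: val_inj => /=.
  by rewrite H2 modnn.
Qed.

Lemma is_diagonalE p q : is_diagonal [set p; q] = (p != q) && ~~ siden p q.
Proof.
apply/existsP/idP => [[r /existsP[s /and3P[rs]]]|/andP[pq sd]].
  rewrite is_sideE set2_eq => H ->; rewrite andbT -val_eqE.
  by move: H rs; rewrite /eqp -val_eqE /=; lia.
by exists p; apply/existsP; exists q; rewrite pq eqxx is_sideE.
Qed.

Lemma is_diagonalP d : is_diagonal d ->
  exists p q, [/\ p.+1 < q, d = [set p; q] & ~~ siden p q].
Proof.
case/existsP=> p /existsP[q /and3P[pq /eqP-> ]]; rewrite is_sideE => sd.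
move: pq; rewrite -val_eqE /=; case: ltngtP => // h _.
  by exists p, q; split=> //; move: sd; rewrite /siden; lia.
exists q, p; rewrite setUC; split=> //; by move: sd; rewrite /siden; lia.
Qed.

Definition noncrossing (D : {set {set vertex}}) : bool :=
  [forall d in D, is_diagonal d && [forall e in D, ~~ xing d e]].

Lemma noncrossingP (D : {set {set vertex}}) :
  reflect ((forall d, d \in D -> is_diagonal d) /\
           (forall d e, d \in D -> e \in D -> ~~ xing d e)) (noncrossing D).
Proof.
apply: (iffP forall_inP) => [H|[H1 H2] d dD]; last first.
  by rewrite H1 //=; apply/forall_inP => e; apply: H2.
split=> [d /H/andP[]//|d e /H/andP[_ /forall_inP]]; exact.
Qed.

(** The diagonals together with the side from 0 to [n.+2] have distinct apexes among the [n.+1]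
    remaining vertices. *)
Lemma card_noncrossing (D : {set {set vertex}}) : noncrossing D -> #|D| <= n.
Proof.
case/noncrossingP=> Ddiag Dnc.
pose base (p q : nat) := (p == 0) && (q == n.+2).
pose W := [set w : vertex * vertex | (w.1 < w.2) &&
   (([set w.1; w.2] \in D) || base w.1 w.2)].
have cardW : #|D| < #|W|.
  pose sd : {set vertex} := [set ord0; ord_max].
  have sdD : sd \notin D.
    by apply/negP => /Ddiag; rewrite is_diagonalE /siden /=; lia.
  have <- : #|sd |: D| = #|D|.+1 by rewrite cardsU1 sdD.
  apply: leq_trans (leq_imset_card (fun w : vertex * vertex => [set w.1; w.2]) W).
  apply/subset_leq_card/subsetP => d; rewrite in_setU1 => /orP[/eqP->|dD].
    by apply/imsetP; exists (ord0, ord_max); rewrite ?inE /base /= ?eqxx ?orbT.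
  have [p [q [pq E _]]] := is_diagonalP (Ddiag _ dD); apply/imsetP.
  by exists (p, q) => //; rewrite !inE /= (ltnW pq) -E dD.
pose F (p q : nat) := [exists w in W, (w.1 == p :> nat) && (w.2 == q :> nat)].
have FE w : w \in W -> F w.1 w.2.
  by move=> wW; apply/exists_inP; exists w; rewrite ?eqxx.
have F_long (p q : nat) : F p q -> p.+1 < q.
  case/exists_inP=> -[x y]; rewrite inE /= => /andP[xy H] /andP[/eqP<- /eqP<-].
  case/orP: H => [/Ddiag|/andP[/eqP-> /eqP->]//].
  by rewrite is_diagonalE /siden; lia.
have F_nc (p q r s : nat) : F p q -> F r s -> ~~ crossn p q r s.
  case/exists_inP=> -[x y]; rewrite inE /= => /andP[xy H] /andP[/eqP<- /eqP<-].
  case/exists_inP=> -[z t]; rewrite inE /= => /andP[zt K] /andP[/eqP<- /eqP<-].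
  move: (ltn_ord x) (ltn_ord y) (ltn_ord z) (ltn_ord t) => hx hy hz ht.
  case/orP: H => [H|/andP[/eqP-> /eqP->]]; last by rewrite /crossn /inarc; lia.
  case/orP: K => [K|/andP[/eqP-> /eqP->]]; last by rewrite /crossn /inarc; lia.
  by rewrite -xingE Dnc.
pose f (w : vertex * vertex) : 'I_n.+1 := inord (apex F w.1 w.2).-1.
have /leq_card_in : {in W &, injective f}.
  move=> [x y] [z t] /FE Fw /FE Fw'; rewrite /f /= in Fw Fw' *.
  have [h _ _] := apexP F_long Fw; have [h' _ _] := apexP F_long Fw'.
  have hy := ltn_ord y; have ht := ltn_ord t.
  move/(congr1 (@nat_of_ord _)); rewrite !inordK; try lia.
  move=> E; have [|h1 h2] := apex_inj F_long F_nc Fw Fw'; first lia.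
  by congr (_, _); apply: val_inj.
by rewrite card_ord; lia.
Qed.

End Chords.

(** * Triangulations and flips *)

Section Triangulations.
Variable n : nat.
Local Notation vertex := 'I_n.+3.
Implicit Types (p q r s a b c : vertex) (d e : {set vertex}).
Implicit Types D : {set {set vertex}}.

Definition triset D : bool := noncrossing D && (#|D| == n).

Lemma triset_diag D d : triset D -> d \in D -> is_diagonal d.
Proof.  by case/andP=> /noncrossingP[H _] _; apply: H. Qed.

Lemma triset_nc D d e : triset D -> d \in D -> e \in D -> ~~ xing d e.
Proof.  by case/andP=> /noncrossingP[_ H] _; apply: H. Qed.

Lemma xingxx p q : ~~ xing [set p; q] [set p; q].
Proof.  by rewrite xingE /crossn eqxx. Qed.

(** A further diagonal would exceed the bound of [card_noncrossing]. *)
Lemma triset_max D d : triset D -> is_diagonal d ->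
  (forall e, e \in D -> ~~ xing d e) -> d \in D.
Proof.
move=> tD dd H; apply/negPn/negP => dD.
have [p [q [pq E _]]] := is_diagonalP dd.
have : noncrossing (d |: D).
  apply/noncrossingP; split=> [e|e f].
    rewrite in_setU1 => /orP[/eqP->//|eD].
    exact: triset_diag tD eD.
  rewrite !in_setU1 => /orP[/eqP->|eD] /orP[/eqP->|fD].
  - by rewrite E xingxx.
  - exact: H.
  - by rewrite xingC; apply: H.
  - exact: triset_nc tD eD fD.
move/card_noncrossing; rewrite cardsU1 dD; case/andP: tD => _ /eqP->.
by rewrite add1n ltnn.
Qed.

Lemma triset_subset_eq D D' : triset D -> triset D' -> D \subset D' -> D = D'.
Proof.
by move=> /andP[_ /eqP h] /andP[_ /eqP h'] s; apply/eqP; rewrite eqEcard s h h' /=.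
Qed.

Definition edge D p q : bool := is_side [set p; q] || ([set p; q] \in D).

Lemma edgeC D p q : edge D p q = edge D q p.
Proof.  by rewrite /edge setUC. Qed.

Lemma siden_nc p q r s : siden n p q -> ~~ crossn p q r s.
Proof.
move: (ltn_ord p) (ltn_ord q) (ltn_ord r) (ltn_ord s).
by rewrite /siden /crossn /inarc; lia.
Qed.

Lemma edge_nc D p q r s : triset D -> edge D p q -> edge D r s ->
  ~~ crossn p q r s.
Proof.
move=> tD; rewrite /edge !is_sideE => /orP[/siden_nc-> //|h] /orP[sd|h'].
  by rewrite crossnC siden_nc.
by rewrite -xingE; apply: triset_nc h h'.
Qed.

Lemma edge_max D p q : triset D -> p != q ->
  (forall r s, [set r; s] \in D -> ~~ crossn p q r s) -> edge D p q.
Proof.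
move=> tD pq H; rewrite /edge; case: (boolP (is_side _)) => //= sd.
apply: (triset_max tD); first by rewrite is_diagonalE pq -is_sideE.
move=> e eD; have [r [s [_ E _]]] := is_diagonalP (triset_diag tD eD).
by rewrite E xingE H // -E.
Qed.

Lemma edge_neq D p q : triset D -> edge D p q -> p != q.
Proof.
move=> tD /orP[|/(triset_diag tD)]; last by rewrite is_diagonalE => /andP[].
by rewrite is_sideE /siden -val_eqE /=; move: (ltn_ord p) (ltn_ord q); lia.
Qed.

(** The number of counterclockwise steps from [p] to [q]. *)
Definition fwd (p q : nat) : nat := if p <= q then q - p else q + n.+3 - p.

Lemma fwdE p q : 1 < fwd p q -> p.+1 < q \/ q < p /\ (0 < q \/ p < n.+2).
Proof. by rewrite /fwd; move: (ltn_ord p); case: (leqP p q); lia. Qed.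

Lemma fwd_far (a b c x : nat) :
  a < n.+3 -> b < n.+3 -> c < n.+3 -> x < n.+3 -> cyc3 a b c ->
  crossn b c a x -> cyc3 a x c && (fwd a b < fwd a x).
Proof.
move=> ha hb hc hx abc; rewrite /crossn /inarc => X.
have abxc : cyc4 a b x c by rewrite /cyc4; case/or3P: abc => H; lia.
apply/andP; split; first by move: abxc; rewrite /cyc3 /cyc4; lia.
move=> {X}; rewrite /fwd; case/or4P: abxc => H;
  case: (leqP a b); case: (leqP a x); lia.
Qed.

(** Take for [b] the neighbour of [a] farthest from [a] before [c]. A diagonal of [D] crossing [bc]
    crosses neither [ab] nor [ac], so it ends at [a] and leads to a farther neighbour. *)
Lemma triangle_exists D a c : triset D -> edge D a c -> 1 < fwd a c ->
  exists b, [/\ cyc3 a b c, edge D a b & edge D b c].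
Proof.
move=> tD eac lac; have ha := ltn_ord a; have hc := ltn_ord c.
pose S := [pred b : vertex | cyc3 a b c && edge D a b].
have S0 : S (ordS a).
  apply/andP; split; last by apply/orP; left; apply/existsP; exists a.
  rewrite /cyc3 /=; have := fwdE lac.
  have [E|E] : a.+1 = n.+3 \/ a.+1 < n.+3 by lia.
    by rewrite E modnn; lia.
  by rewrite modn_small //; lia.
case: (arg_maxnP (fun b : vertex => fwd a b) S0) => /= b /andP[abc eab] bmax.
exists b; split=> //; have hb := ltn_ord b.
apply: (edge_max tD); first by rewrite -val_eqE; move: abc; rewrite /cyc3 /=; lia.
move=> r s rsD; apply/negP => X; have ers : edge D r s by rewrite /edge rsD orbT.
have n1 := edge_nc tD eac ers; have n2 := edge_nc tD eab ers.
have hr := ltn_ord r; have hs := ltn_ord s.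
case/orP: (cross_triangle X n1 n2) => /eqP/val_inj E; subst.
  case/andP: (fwd_far ha hb hc hs abc X) => cy lt.
  by have := bmax s; rewrite /= cy ers => /(_ isT); rewrite leqNgt lt.
have Y : crossn b c a r by rewrite crossn_symr.
case/andP: (fwd_far ha hb hc hr abc Y) => cy lt.
by have := bmax r; rewrite /= cy edgeC ers => /(_ isT); rewrite leqNgt lt.
Qed.

Definition quad D (a b c d : vertex) : Prop :=
  cyc4 a b c d /\ [/\ edge D a b, edge D b c, edge D c d & edge D d a].

Lemma quad_rot D (a b c d : vertex) : quad D a b c d -> quad D b c d a.
Proof. by case=> h [*]; split=> //; move: h; rewrite /cyc4; case/or4P=> ->; rewrite ?orbT. Qed.

Lemma diagonal_quad D a c : triset D -> [set a; c] \in D ->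
  exists b d : vertex, quad D a b c d.
Proof.
move=> tD acD; have := triset_diag tD acD.
rewrite is_diagonalE -val_eqE /siden /= => sd.
have eac : edge D a c by rewrite /edge acD orbT.
have eca : edge D c a by rewrite edgeC.
have ha := ltn_ord a; have hc := ltn_ord c.
have [|b [abc eab ebc]] := triangle_exists tD eac.
  by rewrite /fwd; case: (leqP a c); lia.
have [|x [cda ecd eda]] := triangle_exists tD eca.
  by rewrite /fwd; case: (leqP c a); lia.
by exists b, x; split=> //; apply: cyc3_cyc4.
Qed.

Definition flip D (a b c d : vertex) : {set {set vertex}} :=
  [set b; d] |: (D :\ [set a; c]).

Lemma crossn_quad (a b c d : nat) : cyc4 a b c d -> crossn b d a c.
Proof. by rewrite /cyc4 /crossn /inarc; case/or4P; lia. Qed.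

Lemma quad_diag_notin D (a b c d : vertex) : triset D -> [set a; c] \in D ->
  quad D a b c d -> [set b; d] \notin D.
Proof.
move=> tD acD [cy _]; apply/negP => bdD.
by have := triset_nc tD bdD acD; rewrite xingE crossn_quad.
Qed.

Lemma flip_nc D (a b c d r s : vertex) : triset D -> quad D a b c d ->
  [set r; s] \in D :\ [set a; c] -> ~~ crossn b d r s.
Proof.
move=> tD [cy [eab ebc ecd eda]]; rewrite in_setD1 set2_eq => /andP[ne rsD].
have ers : edge D r s by rewrite /edge rsD orbT.
apply/negP => /(quad_cross cy); rewrite (negPf (edge_nc tD eab ers)).
rewrite (negPf (edge_nc tD ebc ers)) (negPf (edge_nc tD ecd ers)).
rewrite (negPf (edge_nc tD eda ers)) /= => E; move: ne E.
by rewrite /eqp; lia.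
Qed.

Lemma triset_flip D (a b c d : vertex) : triset D -> [set a; c] \in D ->
  quad D a b c d -> triset (flip D a b c d).
Proof.
move=> tD acD Q; have nbd := quad_diag_notin tD acD Q; have cy := Q.1.
have X := crossn_quad cy.
apply/andP; split; last first.
  rewrite cardsU1 in_setD1 (negPf nbd) andbF /=.
  case/andP: tD => _ /eqP E; apply/eqP; apply: etrans E.
  by rewrite (cardsD1 [set a; c] D) acD.
have nc e : e \in D :\ [set a; c] -> ~~ xing [set b; d] e.
  move=> eD; have := eD; rewrite in_setD1 => /andP[_ /(triset_diag tD) /is_diagonalP].
  by case=> r [s [_ E _]]; rewrite E xingE (flip_nc tD Q) // -E.
apply/noncrossingP; split=> [e|e f].
  rewrite in_setU1 => /orP[/eqP->|]; last first.
    by rewrite in_setD1 => /andP[_]; exact: (triset_diag tD).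
  rewrite is_diagonalE; apply/andP; split.
    by apply/eqP => E; move: X; rewrite E crossnn.
  by apply/negP => /siden_nc nX; move: X; rewrite (negPf (nX a c)).
rewrite !in_setU1 => /orP[/eqP->|eD] /orP[/eqP->|fD].
- exact: xingxx.
- exact: nc.
- by rewrite xingC; apply: nc.
- move: eD fD; rewrite !in_setD1 => /andP[_ eD] /andP[_ fD].
  exact: triset_nc tD eD fD.
Qed.

Lemma flip_quad D (a b c d : vertex) : triset D -> [set a; c] \in D ->
  quad D a b c d -> quad (flip D a b c d) b c d a.
Proof.
move=> tD acD Q; have [cy [eab ebc ecd eda]] := quad_rot Q.
have H (p q : vertex) : edge D p q -> ~~ eqp p q a c -> edge (flip D a b c d) p q.
  by rewrite /edge in_setU1 in_setD1 !set2_eq => /orP[->//|->] ->; rewrite !orbT.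
split=> //; split; apply: H => //; move: Q.1; rewrite /eqp /cyc4; clear; lia.
Qed.

Definition ncross D p q : nat := #|[set e in D | xing [set p; q] e]|.

Lemma ncross_lt D (p q p' q' a b : vertex) : triset D -> [set a; b] \in D ->
  crossn p q a b -> ~~ crossn p' q' a b ->
  (forall r s, [set r; s] \in D -> crossn p' q' r s -> crossn p q r s) ->
  ncross D p' q' < ncross D p q.
Proof.
move=> tD abD X X' H; apply: proper_card; apply/properP; split.
  apply/subsetP => e; rewrite !in_set => /andP[eD]; rewrite eD /=.
  have [r [s [_ E _]]] := is_diagonalP (triset_diag tD eD); move: eD; rewrite E.
  by rewrite !xingE => /H.
by exists [set a; b]; rewrite !inE abD !xingE.
Qed.

Lemma edge_or_cross D p q : triset D -> p != q -> ~~ edge D p q ->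
  exists2 ab : vertex * vertex, [set ab.1; ab.2] \in D & crossn p q ab.1 ab.2.
Proof.
move=> tD pq npq.
case: (pickP [pred ab : vertex * vertex |
    ([set ab.1; ab.2] \in D) && crossn p q ab.1 ab.2]) => [ab /andP[]|H].
  by exists ab.
case/negP: npq; apply: (edge_max tD pq) => r s rsD.
by have := H (r, s); rewrite /= rsD => /negbT.
Qed.

(* Resolving the crossing of a chord with a diagonal of [D] produces four
   chords that cross fewer diagonals of [D]. *)
Lemma chord_ind D (Pr : vertex -> vertex -> Prop) : triset D ->
  (forall p q, edge D p q -> Pr p q) ->
  (forall p a q b, cyc4 p a q b -> [set a; b] \in D ->
     Pr p a -> Pr a q -> Pr q b -> Pr b p -> ~~ edge D p q -> Pr p q) ->
  forall p q, p != q -> Pr p q.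
Proof.
move=> tD P0 P1 p q pq; have [m] := ubnP (ncross D p q).
elim: m p q pq => // m IH p q pq lt.
case: (boolP (edge D p q)) => [/P0//|npq].
have [[a b] /= abD X] := edge_or_cross tD pq npq.
have {a b abD X} [a [b [abD cy]]] : exists a b : vertex, [set a; b] \in D /\ cyc4 p a q b.
  case/orP: (crossn_cyc4 X) => cy; first by exists a, b.
  by exists b, a; rewrite setUC.
have X : crossn p q a b by rewrite crossnC; apply: crossn_quad.
have nc r s : [set r; s] \in D -> ~~ crossn a b r s.
  by move=> rsD; rewrite -xingE; apply: triset_nc rsD.
(* By [quad_subcross], whatever in [D] crosses one of the four new chords crosses [pq]; moreover
   [ab] crosses [pq] and none of them. *)
have sub p' q' : ~~ crossn p' q' a b ->
    (forall r s : nat, crossn p' q' r s ->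
    [|| crossn p a r s, crossn a q r s, crossn q b r s | crossn b p r s]) ->
    ncross D p' q' < m.
  move=> n' H; apply: leq_trans (ltnSE lt).
  apply: (ncross_lt tD abD X n') => r s /nc rsD /H; exact: quad_subcross cy rsD.
have [p1 p2 p3 p4] : [/\ p != a, a != q, q != b & b != p].
  move: cy; rewrite -!val_eqE /cyc4 /=; split; lia.
apply: (P1 p a q b cy abD _ _ _ _ npq); apply: IH => //; apply: sub.
- by rewrite /crossn eqxx /= !andbF.
- by move=> r s ->.
- by rewrite /crossn eqxx.
- by move=> r s ->; rewrite orbT.
- by rewrite /crossn eqxx /= !andbF.
- by move=> r s ->; rewrite !orbT.
- by rewrite /crossn eqxx /= !andbF.
- by move=> r s ->; rewrite !orbT.
Qed.

End Triangulations.

(** * Linear dependences of crossing vectors *)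

Section Relations.
Variable n : nat.
Local Notation vertex := 'I_n.+3.
Variable T : 'I_n -> {set vertex}.
Hypothesis Tinj : injective T.
Hypothesis trT : triset (T @: [set: 'I_n]).

(* [chi] and [inT] are sealed, lest unification unfold the finite
   quantifications hidden in their definitions. *)
Fact chi_key : {f : {set vertex} -> 'I_n -> int |
  forall d i, f d i = if T i == d then (-1)%R else Posz (xing d (T i))}.
Proof. by exists (fun d i => if T i == d then (-1)%R else Posz (xing d (T i))). Qed.

Definition chi := sval chi_key.

Lemma chi_def d i : chi d i = if T i == d then (-1)%R else Posz (xing d (T i)).
Proof. exact: (svalP chi_key). Qed.

Lemma chord_ends i : exists r s : vertex, r.+1 < s /\ T i = [set r; s].
Proof using trT.
have /is_diagonalP[r [s [rs E _]]] : is_diagonal (T i).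
  by apply: (triset_diag trT); apply: imset_f.
by exists r, s.
Qed.

Lemma chiE (p q r s : vertex) i : T i = [set r; s] ->
  chi [set p; q] i = chin p q r s.
Proof.
move=> E; rewrite chi_def /chin E set2_eq xingE.
by rewrite eqpC.
Qed.

Lemma T_nc i j : ~~ xing (T i) (T j).
Proof using trT. by apply: (triset_nc trT); apply: imset_f. Qed.

Lemma T_nc_ends i j (p q r s : vertex) : T i = [set p; q] -> T j = [set r; s] ->
  ~~ crossn p q r s.
Proof using trT. by move=> E F; rewrite -xingE -E -F T_nc. Qed.

Fact inT_key : {f : {set vertex} -> bool |
  forall d, f d <-> exists i, T i = d}.
Proof.
exists (fun d => [exists i, T i == d]) => d.
by split=> [/existsP|] -[i /eqP E]; [|apply/existsP]; exists i => //; apply/eqP.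
Qed.

Definition inT := sval inT_key.

Lemma inTP d : reflect (exists i, T i = d) (inT d).
Proof. by apply/(iffP idP); apply (svalP inT_key d). Qed.

Lemma chi_T k i : chi (T k) i = (- (i == k)%:R)%R.
Proof using Tinj trT.
rewrite chi_def; have [r [s [_ E]]] := chord_ends k.
have [r' [s' [_ F]]] := chord_ends i; rewrite (inj_eq Tinj); case: eqP => //= ik.
by rewrite E F xingE (negPf (T_nc_ends E F)) oppr0.
Qed.

Lemma chi_side (p q : vertex) i : is_side [set p; q] -> chi [set p; q] i = 0%R.
Proof using trT.
rewrite is_sideE => sd; have [r [s [rs E]]] := chord_ends i.
have ne : ~~ eqp p q r s.
  have : ~~ siden n r s.
    have : is_diagonal (T i) by apply: (triset_diag trT); apply: imset_f.
    by rewrite E is_diagonalE => /andP[].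
  by move: sd; rewrite /siden /eqp; lia.
by rewrite (chiE _ _ E) /chin (negPf ne) (negPf (siden_nc _ _ sd)).
Qed.



(** The product of the lengths of the two arcs cut off by the chord; [m] is the distance of the
    labels, written with truncated subtraction. *)
Definition area (p q : nat) : nat :=
  let m := (p - q) + (q - p) in m * (n.+3 - m).

Lemma areaC p q : area p q = area q p.
Proof. by rewrite /area addnC. Qed.

Lemma areaE p q m k : q = p + m -> m + k = n.+3 -> area p q = m * k.
Proof. by rewrite /area => -> <-; congr (_ * _); lia. Qed.

(** In terms of the four arc lengths, the first difference is twice the product of the arcs [bc] and
    [da], the second twice the product of [ab] and [cd]. *)
Lemma area_sorted (a b c d : nat) : (a < b < c) && (c < d) -> d < n.+3 ->
  (area a b + area c d < area a c + area b d) /\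
  (area b c + area d a < area a c + area b d).
Proof.
case/andP=> /andP[ab bc] cd dn.
have [u Eb] : exists u, b = a + u.+1 by exists (b - a).-1; lia.
have [v Ec] : exists v, c = b + v.+1 by exists (c - b).-1; lia.
have [w Ed] : exists w, d = c + w.+1 by exists (d - c).-1; lia.
have [t Et] : exists t, n.+3 = u.+1 + v.+1 + w.+1 + t.+1.
  by exists (n.+3 - (d - a)).-1; lia.
rewrite (areaC d a) (@areaE a b u.+1 (v.+1 + w.+1 + t.+1)); try lia.
rewrite (@areaE c d w.+1 (u.+1 + v.+1 + t.+1)); try lia.
rewrite (@areaE a c (u.+1 + v.+1) (w.+1 + t.+1)); try lia.
rewrite (@areaE b d (v.+1 + w.+1) (u.+1 + t.+1)); try lia.
rewrite (@areaE b c v.+1 (u.+1 + w.+1 + t.+1)); try lia.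
rewrite (@areaE a d (u.+1 + v.+1 + w.+1) t.+1); lia.
Qed.

Lemma area_concave (a b c d : nat) :
  a < n.+3 -> b < n.+3 -> c < n.+3 -> d < n.+3 -> cyc4 a b c d ->
  area a b + area c d < area a c + area b d.
Proof.
move=> an bn cn dn; case/or4P=> H.
- by have [] := area_sorted H dn.
- by have [_] := area_sorted H an; rewrite (areaC c a); lia.
- by have [+ _] := area_sorted H bn; rewrite (areaC c a) (areaC d b); lia.
- by have [_] := area_sorted H cn; rewrite (areaC d b); lia.
Qed.

Definition area_max : nat := n.+3 ^ 2.

Lemma area_le (p q : nat) : p < n.+3 -> q < n.+3 -> area p q <= area_max.
Proof. by move=> pn qn; rewrite /area /area_max -mulnn leq_mul; lia. Qed.

(** Larger than the sum of any two areas. *)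
Definition heavy : nat := (2 * area_max).+1.

(* The concave [area] decides the dependences whose right-hand side consists of
   two opposite sides, the constants [heavy] decide all others. *)
Definition omega (d : {set vertex}) : nat :=
  if inT d then 2 * heavy else if is_side d then 0 else
  heavy + (if [pick w : vertex * vertex | d == [set w.1; w.2]] is Some w
           then area w.1 w.2 else 0).

Lemma omegaE (p q : vertex) : omega [set p; q] =
  if inT [set p; q] then 2 * heavy else if siden n p q then 0 else
  heavy + area p q.
Proof.
rewrite /omega is_sideE; case: ifP => // _; case: ifP => // _; congr (_ + _).
case: pickP => [[x y] /=|/(_ (p, q))]; last by rewrite eqxx.
by rewrite set2_eq /eqp => /orP[]/andP[/eqP-> /eqP->] //; rewrite areaC.
Qed.

(** Positivity of [x] and [y] allows the relation to be solved for either diagonal of the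
    quadrilateral. *)
Definition dependence (a b c d : vertex) : Prop :=
  exists x y s t u v : nat, [/\ 0 < x, 0 < y,
    forall i, (chi [set a; c] i *+ x + chi [set b; d] i *+ y =
      chi [set a; b] i *+ s + chi [set b; c] i *+ t + chi [set c; d] i *+ u
      + chi [set d; a] i *+ v)%R &
    s * omega [set a; b] + t * omega [set b; c] + u * omega [set c; d]
      + v * omega [set d; a] < x * omega [set a; c] + y * omega [set b; d]].

Lemma dependence_rot (a b c d : vertex) :
  dependence b c d a -> dependence a b c d.
Proof.
case=> x [y [s [t [u [v [x0 y0 E L]]]]]]; exists y, x, v, s, t, u; split=> //.
- by move=> i; have := E i; rewrite (setUC [set c] [set a]) => F;
    rewrite addrC F addrC !addrA.
- by move: L; rewrite (setUC [set c] [set a]); lia.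
Qed.

Lemma omega_ge_diag (p q : vertex) : p != q -> ~~ siden n p q ->
  heavy + area p q <= omega [set p; q].
Proof.
move=> pq sd; rewrite omegaE (negPf sd); case: ifP => // _.
by have := area_le (ltn_ord p) (ltn_ord q); rewrite /heavy; lia.
Qed.

Lemma omega_notT (p q : vertex) : ~~ inT [set p; q] ->
  omega [set p; q] <= heavy + area p q.
Proof. by move=> pq; rewrite omegaE (negPf pq); case: ifP. Qed.

Lemma crossn_nside (p q r s : vertex) : crossn p q r s -> ~~ siden n p q.
Proof. by move=> X; apply/negP => sd; move: X; apply/negP/siden_nc. Qed.

Lemma crossn_neq (p q r s : vertex) : crossn p q r s -> p != q.
Proof. by apply: contraL => /eqP->; rewrite crossnn. Qed.

Lemma crossn_notT (p q r s : vertex) i : T i = [set r; s] -> crossn p q r s ->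
  ~~ inT [set p; q].
Proof using trT.
move=> E X; apply/inTP => -[j F].
by have := T_nc_ends F E; rewrite X.
Qed.

(** Omitting the chords of [T] removes the coordinates -1 and loses no crossing, since diagonals of
    [T] do not cross each other. *)
Lemma chi_cross (p q : vertex) i r s : T i = [set r; s] ->
  (chi [set p; q] i *+ ~~ inT [set p; q] = Posz (crossn p q r s))%R.
Proof using trT.
move=> E; case: (boolP (inT _)) => [/inTP[j F]|nT].
  by rewrite mulr0n (negPf (T_nc_ends F E)).
rewrite mulr1n (chiE _ _ E) /chin ifN //; apply: contra nT => e.
by apply/inTP; exists i; rewrite E; apply/eqP; rewrite set2_eq eqpC.
Qed.

(** The maximum in [tropical_cross] is always attained at [ab], [cd], so [v(ac) + v(bd)] is the sum
    of [v(ab)] and [v(cd)], with sides in [T] omitted. At most two terms [heavy] occur on the right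
    and at least two on the left; [area_concave] decides. *)
Lemma dependence_opposite (a b c d : vertex) : cyc4 a b c d ->
  (forall i (r s : vertex), T i = [set r; s] -> ~~ prefers b c d a r s) ->
  dependence a b c d.
Proof using trT.
move=> cy H; have X := crossn_quad cy.
have ndb : ~~ siden n b d := crossn_nside X.
have Y : crossn a c b d by rewrite crossnC.
have nac := crossn_nside Y.
exists 1, 1, (~~ inT [set a; b] : nat), 0, (~~ inT [set c; d] : nat), 0.
split=> // [i|].
  have [r [s [_ E]]] := chord_ends i.
  have := chi_cross a b E; have := chi_cross c d E.
  move: (inT [set a; b]) (inT [set c; d]) => e f -> ->.
  rewrite !mulr1n !mulr0n !addr0 !(chiE _ _ E) (eqP (tropical_cross r s cy)).
  by have := H i r s E; rewrite /prefers; lia.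
have L (p q : vertex) : ~~ inT [set p; q] * omega [set p; q] <= heavy + area p q.
  by case: (boolP (inT _)) => // /omega_notT; rewrite mul1n.
have := L a b; have := L c d; have := omega_ge_diag (crossn_neq X) ndb.
have := omega_ge_diag (crossn_neq Y) nac.
have := area_concave (ltn_ord a) (ltn_ord b) (ltn_ord c) (ltn_ord d) cy.
by lia.
Qed.

(** The sides [bc] and [cd] are crossed by diagonals of [T], so their heights add up to at most
    [2 * heavy + 2 * area_max], which is less than [3 * heavy]; the left-hand side reaches
    [3 * heavy] whether or not [ac] is in [T]. *)
Lemma dependence_fan (a b c d : vertex) i j (r s r' s' : vertex) :
  cyc4 a b c d -> T i = [set r; s] -> T j = [set r'; s'] ->
  fan_at a b c d r s r' s' -> dependence a b c d.
Proof using trT.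
move=> cy Ei Ej.
wlog ra : r s Ei / r = a.
  move=> W F; have := F => /andP[/orP[]/eqP/val_inj h _]; first exact: (W r s).
  apply: (W s r) => //; first by rewrite setUC.
  by move: F; rewrite /fan_at orbC (crossn_symr c d).
wlog ra' : r' s' Ej / r' = a.
  move=> W F; have := F => /and3P[_ /orP[]/eqP/val_inj h _]; first exact: (W r' s').
  apply: (W s' r') => //; first by rewrite setUC.
  by move: F; rewrite /fan_at (orbC (s' == a :> nat)) (crossn_symr b c).
subst r r' => /and4P[_ _ Xcd Xbc].
have X := crossn_quad cy; have ndb : ~~ siden n b d := crossn_nside X.
have Y : crossn a c b d by rewrite crossnC.
have nac := crossn_nside Y.
(* The coefficient of [ac] is 2, or 1 if [ac] is in [T]: the two cases of [fan_relation]. *)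
exists (~~ inT [set a; c]).+1, 1, 0, 1, 1, 0; split=> // [k|].
  have [x [y [_ Ek]]] := chord_ends k; rewrite !(chiE _ _ Ek).
  have /andP[R2 R1] := fan_relation cy Xcd Xbc (T_nc_ends Ek Ei) (T_nc_ends Ek Ej).
  case: (boolP (inT _)) => [/inTP[l El]|nT] /=.
    by rewrite (negPf (T_nc_ends El Ek)) in R1; rewrite !mulr1n !mulr0n addr0 add0r (eqP R1).
  rewrite !mulr1n !mulr0n addr0 add0r.
  case/orP: R2 => [e|/eqP->//]; case/negP: nT; apply/inTP; exists k.
  by rewrite Ek; apply/eqP; rewrite set2_eq eqpC.
have L (p q : vertex) : ~~ inT [set p; q] -> omega [set p; q] <= heavy + area_max.
  move=> /omega_notT/leq_trans; apply; rewrite leq_add2l.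
  exact: area_le (ltn_ord p) (ltn_ord q).
have := L _ _ (crossn_notT Ei Xcd); have := L _ _ (crossn_notT Ej Xbc).
have := omega_ge_diag (crossn_neq X) ndb.
have := omega_ge_diag (crossn_neq Y) nac.
case: (boolP (inT [set a; c])) => acT /=; rewrite /heavy; last lia.
by rewrite [omega [set a; c]]/omega acT /heavy; lia.
Qed.

(** If one of the two pairs of opposite sides is preferred by no diagonal of [T], the other pair
    carries the relation. Otherwise [prefers_conflict] yields a fan at one of the four vertices. *)
Lemma dependence_exists (a b c d : vertex) : cyc4 a b c d -> dependence a b c d.
Proof using Tinj trT.
move=> cy; have rot (p q r s : nat) : cyc4 p q r s -> cyc4 q r s p.
  by rewrite /cyc4; lia.
case: (pselect (exists i (r s : vertex), T i = [set r; s] /\ prefers b c d a r s));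
    last first.
  move=> H; apply: dependence_opposite cy _ => i r s E; apply/negP => P; apply: H.
  by exists i, r, s.
case=> j [r' [s' [Ej Pj]]].
case: (pselect (exists i (r s : vertex), T i = [set r; s] /\ prefers a b c d r s));
    last first.
  move=> H; apply/dependence_rot/dependence_opposite; first exact: rot.
  move=> i r s E; apply/negP => P; apply: H; exists i, r, s; split=> //.
  by move: P; rewrite /prefers; lia.
case=> i [r [s [Ei Pi]]].
have cy1 := rot _ _ _ _ cy; have cy2 := rot _ _ _ _ cy1; have cy3 := rot _ _ _ _ cy2.
case/or4P: (prefers_conflict cy Pi Pj (T_nc_ends Ei Ej)) => F.
- exact: dependence_fan cy Ei Ej F.
- apply/dependence_rot; exact: dependence_fan cy1 Ej Ei F.
- apply/dependence_rot/dependence_rot; exact: dependence_fan cy2 Ei Ej F.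
- apply/dependence_rot/dependence_rot/dependence_rot.
  exact: dependence_fan cy3 Ej Ei F.
Qed.

End Relations.

(** * Complete fans from heights *)

Local Open Scope ring_scope.

Section Dot.
Variables (R : realType) (n : nat).
Implicit Types (x y u : 'rV[R]_n).

Lemma dotC x y : dot x y = dot y x.
Proof. by apply: eq_bigr => i _; rewrite mulrC. Qed.

Lemma dotDr u x y : dot u (x + y) = dot u x + dot u y.
Proof. by rewrite /dot -big_split; apply: eq_bigr => i _; rewrite mxE mulrDr. Qed.

Lemma dotZr u a x : dot u (a *: x) = a * dot u x.
Proof. by rewrite /dot mulr_sumr; apply: eq_bigr => i _; rewrite mxE mulrCA. Qed.

Lemma dot0r u : dot u 0 = 0.
Proof. by rewrite /dot big1 // => i _; rewrite mxE mulr0. Qed.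

Lemma dot_sumr u (I : finType) (P : pred I) (c : I -> R) (g : I -> 'rV[R]_n) :
  dot u (\sum_(i | P i) c i *: g i) = \sum_(i | P i) c i * dot u (g i).
Proof.
rewrite (big_morph _ (dotDr u) (dot0r u)).
by apply: eq_bigr => i _; rewrite dotZr.
Qed.

End Dot.

Section AbstractFan.
Variables (R : realType) (n : nat) (I : finType).
Local Notation V := 'rV[R]_n.
Variables (v : I -> V) (w : I -> R) (Tri : pred {set I}).
(** Linear independence of the rays of [D], stated as the existence of functionals with prescribed
    values on them. *)
Hypothesis dual : forall D, Tri D -> forall f : I -> R,
  exists y, forall i, i \in D -> dot y (v i) = f i.
Hypothesis span : forall D, Tri D -> forall x,
  exists c : I -> R, x = \sum_(i in D) c i *: v i.
Hypothesis sep : forall D y, Tri D -> (forall i, i \in D -> dot y (v i) = w i) ->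
  forall D' i, Tri D' -> i \in D' -> i \notin D -> dot y (v i) < w i.
Hypothesis flipD : forall D i, Tri D -> i \in D ->
  exists D', [/\ Tri D', D :\ i \subset D' & i \notin D'].
Variable D0 : {set I}.
Hypothesis TD0 : Tri D0.

Definition subcone (S : {set I}) : set V := cone v (fun i => i \in S).

Definition subcones : set (set V) :=
  [set C | exists D S : {set I}, [/\ Tri D, S \subset D & C = subcone S]]%classic.

Lemma sum_restrict (S S' : {set I}) (c : I -> R) : S \subset S' ->
  \sum_(i in S) c i *: v i =
  \sum_(i in S') (if i \in S then c i else 0) *: v i.
Proof.
move=> SS'; rewrite big_mkcond [RHS]big_mkcond; apply: eq_bigr => i _.
case: (boolP (i \in S)) => [/(subsetP SS')->//|_].
by rewrite scale0r if_same.
Qed.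

Lemma subcone_mono (S S' : {set I}) : S \subset S' ->
  (subcone S `<=` subcone S')%classic.
Proof.
move=> SS' x [c [c0 ->]]; exists (fun i => if i \in S then c i else 0).
by split=> [i|]; [case: ifP | exact: sum_restrict].
Qed.

(** A supporting functional cuts out the rays on which it vanishes; conversely, independence
    provides a functional equal to 0 on [S'] and to 1 on the rest of [S]. *)
Lemma subcone_face (D S : {set I}) : Tri D -> S \subset D ->
  forall F, is_face F (subcone S) <-> exists2 S' : {set I}, S' \subset S & F = subcone S'.
Proof.
move=> TD SD F; split=> [[u [u0 ->]]|[S' S'S ->]].
  exists [set i in S | dot u (v i) == 0].
    by apply/subsetP => i; rewrite inE => /andP[].
  have uv i : i \in S -> 0 <= dot u (v i).
    move=> iS; apply: u0; exists (fun j => (j == i)%:R); split.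
      by move=> j; rewrite ler0n.
    rewrite (bigD1 i) //= eqxx scale1r big1 ?addr0 // => j /andP[_ /negPf->].
    by rewrite scale0r.
  apply/seteqP; split=> x /=.
    case=> -[c [c0 ->]]; rewrite dot_sumr => /psumr_eq0P H.
    have {}H i : i \in S -> c i * dot u (v i) = 0.
      by apply: H => j jS; rewrite mulr_ge0 ?c0 ?uv.
    exists c; split=> //; rewrite [RHS]big_mkcond [LHS]big_mkcond /=.
    apply: eq_bigr => i _; rewrite inE; case: (boolP (i \in S)) => //= iS.
    have /eqP := H i iS; rewrite mulf_eq0.
    by case: (dot u (v i) == 0); rewrite // orbF => /eqP->; rewrite scale0r.
  move=> Cx; split.
    by apply: subcone_mono Cx; apply/subsetP => i; rewrite inE => /andP[].
  case: Cx => c [c0 ->].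
  by rewrite dot_sumr big1 // => i; rewrite inE => /andP[_ /eqP->]; rewrite mulr0.
have [u uE] := dual TD (fun i => (i \notin S')%:R).
have uS i : i \in S -> dot u (v i) = (i \notin S')%:R.
  by move=> iS; apply/uE/(subsetP SD).
exists u; split=> [x [c [c0 ->]]|].
  by rewrite dot_sumr sumr_ge0 // => i iS; rewrite mulr_ge0 ?c0 // uS // ler0n.
apply/seteqP; split=> x /=.
  move=> Cx; split; first exact: subcone_mono Cx.
  case: Cx => c [c0 ->].
  rewrite dot_sumr big1 // => i iS'; rewrite uS ?(subsetP S'S) // iS' mulr0 //.
case=> -[c [c0 ->]]; rewrite dot_sumr => /psumr_eq0P H.
have {}H i : i \in S -> c i * dot u (v i) = 0.
  by apply: H => j jS; rewrite mulr_ge0 ?c0 // uS // ler0n.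
exists c; split=> //; rewrite [RHS]big_mkcond [LHS]big_mkcond /=.
apply: eq_bigr => i _; case: (boolP (i \in S')) => [/(subsetP S'S)->//|iS'].
case: ifP => // iS; have := H i iS.
by rewrite uS // iS' mulr1 => ->; rewrite scale0r.
Qed.

Lemma heights_exist : exists y : {set I} -> V,
  forall D, Tri D -> forall i, i \in D -> dot (y D) (v i) = w i.
Proof.
suff /choice[y H] : forall D, exists y, Tri D -> forall i, i \in D -> dot y (v i) = w i.
  by exists y.
move=> D; case: (boolP (Tri D)) => [TD|_]; last by exists 0.
by have [y H] := dual TD w; exists y.
Qed.

Section Heights.
Variable y : {set I} -> V.
Hypothesis yE : forall D, Tri D -> forall i, i \in D -> dot (y D) (v i) = w i.

Lemma y_le D D' i : Tri D -> Tri D' -> i \in D' -> dot (y D) (v i) <= w i.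
Proof.
move=> TD TD' iD'; case: (boolP (i \in D)) => [iD|iD]; first by rewrite yE.
by rewrite ltW // (sep TD (yE TD) TD').
Qed.

Lemma y_eq D D' i : Tri D -> Tri D' -> i \in D' -> dot (y D) (v i) = w i -> i \in D.
Proof.
move=> TD TD' iD' E; apply/negPn/negP => iD.
by have := sep TD (yE TD) TD' iD' iD; rewrite E ltxx.
Qed.

(* If [y D] maximizes [x] among the heights, then [x] lies in the cone of [D]:
   exchanging a ray with a negative coefficient would increase the value. *)
Lemma complete x : exists (D S : {set I}) (c : I -> R),
  [/\ Tri D, S \subset D, forall i, i \in S -> 0 < c i &
      x = \sum_(i in S) c i *: v i].
Proof.
case: (arg_maxP (fun D => dot (y D) x) TD0) => D TD Dmax.
have [c xE] := span TD x.
have c0 i : i \in D -> 0 <= c i.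
  move=> iD; rewrite leNgt; apply/negP => ci.
  have [D' [TD' /subsetP DD' iD']] := flipD TD iD.
  have /= := Dmax D' TD'; rewrite xE !dot_sumr leNgt => /negP; apply.
  rewrite (bigD1 i) // [ltRHS](bigD1 i) //=.
  apply: ltr_leD.
    by rewrite ltr_nM2l // (yE TD iD) (sep TD' (yE TD') TD).
  rewrite le_eqVlt (eq_bigr (fun j => c j * dot (y D') (v j))) ?eqxx //.
  move=> j /andP[jD ji]; rewrite (yE TD jD) (yE TD') //.
  by apply: DD'; rewrite in_setD1 ji.
exists D, [set i in D | 0 < c i], c; split=> //.
- by apply/subsetP => i; rewrite inE => /andP[].
- by move=> i; rewrite inE => /andP[].
rewrite xE big_mkcond [RHS]big_mkcond; apply: eq_bigr => i _.
rewrite inE; case: (boolP (i \in D)) => //= iD; case: ifP => // /negbT.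
by rewrite -leNgt => ci; rewrite (_ : c i = 0) ?scale0r //; apply/le_anti; rewrite ci c0.
Qed.

(* Both heights take the same value on a common point of the two cones. *)
Lemma subcone_cap (D D' S S' : {set I}) x : Tri D -> Tri D' -> S \subset D -> S' \subset D' ->
  subcone S x -> subcone S' x -> subcone (S :&: S') x.
Proof.
move=> TD TD' /subsetP SD /subsetP SD' [c [c0 xE]] [c' [c'0 xE']].
have H : forall i, i \in S' -> c' i != 0 -> i \in D.
  (* This sum is [dot (y D') x - dot (y D) x], and expanding [x] over [S] shows that it is at most
     0. Its terms are nonnegative, hence all vanish. *)
  have : \sum_(i in S') c' i * (w i - dot (y D) (v i)) <= 0.
    under eq_bigr do rewrite mulrBr.
    rewrite sumrB subr_le0 -(dot_sumr (y D)) -xE' [in leRHS]xE dot_sumr.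
    apply: (@le_trans _ _ (dot (y D') x)).
      by rewrite xE' dot_sumr ler_sum // => i iS; rewrite (yE TD') ?SD'.
    rewrite xE dot_sumr ler_sum // => i iS; rewrite ler_wpM2l ?c0 //.
    by rewrite (yE TD) ?SD //; apply: (y_le TD' TD); rewrite SD.
  rewrite le_eqVlt ltNge sumr_ge0 /= ?orbF => [|i iS]; last first.
    by rewrite mulr_ge0 ?c'0 // subr_ge0 (y_le TD TD') ?SD'.
  move=> /eqP/psumr_eq0P K i iS ci.
  have /eqP : c' i * (w i - dot (y D) (v i)) = 0.
    apply: K iS => j jS; rewrite mulr_ge0 ?c'0 // subr_ge0.
    by rewrite (y_le TD TD') ?SD'.
  rewrite mulf_eq0 (negPf ci) /=.
  by rewrite subr_eq0 eq_sym => /eqP; apply: (y_eq TD TD' (SD' i iS)).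
(* Both expansions of [x] now involve only rays of [D], and the functional dual to the ray [i]
   compares their coefficients. *)
have E i : i \in S' -> c' i != 0 -> i \in S.
  move=> iS' ci; have iD := H i iS' ci; apply/negPn/negP => iS.
  have [u uE] := dual TD (fun j => (j == i)%:R).
  have : dot u x = 0.
    rewrite xE dot_sumr big1 // => j jS; rewrite uE ?SD //.
    by case: eqP => [ji|]; rewrite ?mulr0 //; rewrite -ji jS in iS.
  rewrite xE' dot_sumr (bigD1 i) //= uE // eqxx mulr1 big1 ?addr0 => [/eqP|j].
    by rewrite (negPf ci).
  case/andP=> jS' ji; have [->|cj] := eqVneq (c' j) 0; first by rewrite mul0r.
  by rewrite uE ?(H j) // (negPf ji) mulr0.
exists c'; split=> //; rewrite xE' big_mkcond [RHS]big_mkcond; apply: eq_bigr => i _ /=.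
rewrite inE; case: (boolP (i \in S')) => iS'; rewrite ?andbF // andbT.
have [->|ci] := eqVneq (c' i) 0; first by rewrite scale0r if_same.
by rewrite E.
Qed.

Lemma subcone_simplicial (D S : {set I}) : Tri D -> S \subset D -> simplicial_cone (subcone S).
Proof.
move=> TD SD; exists #|S|, (fun k => v (enum_val k)); split.
  apply/row_freeP.
  have uex (k : 'I_#|S|) : exists u, forall i, i \in D -> dot u (v i) = (i == enum_val k)%:R.
    exact: dual TD _.
  have [u uE] := choice uex; exists (\matrix_(i, k) u k 0 i).
  apply/matrixP => k l; rewrite !mxE.
  transitivity (dot (u l) (v (enum_val k))).
    by apply: eq_bigr => i _; rewrite !mxE mulrC.
  by rewrite uE ?(inj_eq enum_val_inj) // (subsetP SD) // enum_valP.
apply/seteqP; split=> x [c [c0 ->]].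
  exists (fun k => c (enum_val k)); split=> //.
  by rewrite (big_enum_val (fun i => c i *: v i)).
have inj := @enum_val_inj I (fun i => i \in S).
exists (fun i => \sum_(k | enum_val k == i) c k); split.
  by move=> i; apply: sumr_ge0.
rewrite [RHS]big_enum_val /=; apply: eq_bigr => k _; congr (_ *: _).
rewrite (big_pred1 k) // => l /=; exact: (inj_eq inj).
Qed.

Lemma polyhedral_simplicial (C : set V) : simplicial_cone C -> polyhedral_cone C.
Proof. by case=> m [g [_ E]]; exists m, g. Qed.

Lemma subcones_fan : complete_simplicial_fan subcones.
Proof.
split; first split.
- apply: (@sub_finite_set _ _ [set subcone S | S in [set: {set I}]]%classic).
    by move=> C [D [S [_ _ ->]]]; exists S.
  exact/finite_image/finite_finset.
- by move=> C [D [S [TD SD ->]]]; apply/polyhedral_simplicial/(subcone_simplicial TD).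
- move=> C F [D [S [TD SD ->]]] /(subcone_face TD SD)[S' S'S ->].
  by exists D, S'; split=> //; apply: subset_trans SD.
- move=> C C' [D [S [TD SD ->]]] [D' [S' [TD' SD' ->]]].
  have -> : (subcone S `&` subcone S' = subcone (S :&: S'))%classic.
    apply/seteqP; split=> x; first by case; apply: (subcone_cap TD TD').
    by move=> H; split; apply: (subcone_mono _ H); rewrite ?subsetIl ?subsetIr.
  split; first by apply/(subcone_face TD SD); exists (S :&: S'); rewrite ?subsetIl.
  by apply/(subcone_face TD' SD'); exists (S :&: S'); rewrite ?subsetIr.
- move=> x; have [D [S [c [TD SD c0 xE]]]] := complete x.
  exists (subcone S); split; first by exists D, S.
  exists (fun i => if i \in S then c i else 0); split.
    by move=> i; case: ifP => // /c0/ltW.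
  by rewrite xE; apply: eq_bigr => i ->.
- by move=> C [D [S [TD SD ->]]]; apply: (subcone_simplicial TD).
Qed.

(** Each ray satisfies [dot (y D') (v i) <= w i]; equality of the positively weighted sums forces
    equality for every ray, which by [y_eq] places it in [D']. *)
Lemma rays_positive_sum (S : {set I}) (D : {set I}) (c : I -> R) D' :
  Tri D -> Tri D' -> S \subset D -> (forall i, i \in S -> 0 < c i) ->
  \sum_(i in S) c i * w i <= dot (y D') (\sum_(i in S) c i *: v i) ->
  S \subset D'.
Proof.
move=> TD TD' /subsetP SD c0; rewrite dot_sumr => le.
have : \sum_(i in S) c i * (w i - dot (y D') (v i)) = 0.
  apply/le_anti; rewrite sumr_ge0 => [|i iS]; last first.
    by rewrite mulr_ge0 ?(ltW (c0 _ iS)) // subr_ge0 (y_le TD' TD) ?SD.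
  by rewrite (eq_bigr _ (fun i _ => mulrBr _ _ _)) sumrB subr_le0 le.
move/psumr_eq0P => K; apply/subsetP => i iS.
have /eqP : c i * (w i - dot (y D') (v i)) = 0.
  apply: K iS => j jS; rewrite mulr_ge0 ?(ltW (c0 _ jS)) // subr_ge0.
  by rewrite (y_le TD' TD) ?SD.
rewrite mulf_eq0 gt_eqF ?c0 //= subr_eq0 eq_sym => /eqP.
by apply: (y_eq TD' TD); apply: SD.
Qed.

(** For the convex hull of the points [y D], the normal cone of the face maximizing [u] is the cone
    over the set [S] of rays that have positive coefficients in [u]. *)
Lemma normal_fan_subcones : exists Q : set V,
  is_polytope Q /\ normal_fan Q = subcones.
Proof.
pose s := enum Tri; have s0 : (0 < size s)%N.
  by rewrite -cardE; apply/card_gt0P; exists D0.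
have [m sm] : exists m, size s = m.+1 by exists (size s).-1; rewrite prednK.
pose p (k : 'I_m.+1) := y (nth D0 s k).
have pT (k : 'I_m.+1) : Tri (nth D0 s k).
  have /(mem_nth D0) : (k < size s)%N by rewrite sm.
  by rewrite mem_enum.
pose Q := [set x | exists c : 'I_m.+1 -> R,
  [/\ forall i, 0 <= c i, \sum_i c i = 1 & x = \sum_i c i *: p i]]%classic.
have yQ D : Tri D -> Q (y D).
  move=> TD; have Ds : D \in s by rewrite mem_enum.
  have lt : (index D s < m.+1)%N by rewrite -sm index_mem.
  exists (fun k => (k == Ordinal lt)%:R); split=> [k||].
  - by rewrite ler0n.
  - by rewrite (bigD1 (Ordinal lt)) //= eqxx big1 ?addr0 // => k /negPf->.
  rewrite (bigD1 (Ordinal lt)) //= eqxx scale1r big1 ?addr0 => [|k /negPf->].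
    by rewrite /p /= nth_index.
  by rewrite scale0r.
have Qle u r : (forall D, Tri D -> dot u (y D) <= r) -> forall x, Q x -> dot u x <= r.
  move=> H x [c [c0 c1 ->]]; rewrite dot_sumr -[r]mul1r -c1 mulr_suml.
  by apply: ler_sum => k _; rewrite ler_wpM2l // H // pT.
exists Q; split; first by exists m, p.
(* The support function of [Q] is linear on each cone with value [w i] at the ray [v i]; [maxy]
   shows that the bound is attained. *)
have maxE (D S : {set I}) (c : I -> R) u : Tri D -> S \subset D -> (forall i, i \in S -> 0 <= c i) ->
    u = \sum_(i in S) c i *: v i -> forall x, Q x -> dot u x <= \sum_(i in S) c i * w i.
  move=> TD /subsetP SD c0 ->; apply: Qle => D' TD'; rewrite dotC dot_sumr.
  by apply: ler_sum => i iS; rewrite ler_wpM2l ?c0 // (y_le TD' TD) ?SD.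
have maxy (D S : {set I}) (c : I -> R) u : Tri D -> S \subset D ->
    u = \sum_(i in S) c i *: v i -> dot u (y D) = \sum_(i in S) c i * w i.
  move=> TD /subsetP SD ->; rewrite dotC dot_sumr.
  by apply: eq_bigr => i iS; rewrite yE ?SD.
have NE (D S : {set I}) (c : I -> R) u : Tri D -> S \subset D -> (forall i, i \in S -> 0 < c i) ->
    u = \sum_(i in S) c i *: v i ->
    [set e | (max_face Q u `<=` max_face Q e)%classic]%classic = subcone S.
  move=> TD SD c0 uE; have /subsetP SD' := SD.
  have c0' i : i \in S -> 0 <= c i by move=> /c0/ltW.
  apply/seteqP; split=> e /=.
    move=> sub; have [D' [S' [c' [TD' S'D' c'0 eE]]]] := complete e.
    have c'0' i : i \in S' -> 0 <= c' i by move=> /c'0/ltW.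
    (* The point [y D2] maximizes [u], hence also [e], so that [rays_positive_sum] applies to
       [e]. *)
    have K D2 : Tri D2 -> S \subset D2 -> S' \subset D2.
      move=> TD2 SD2; have : max_face Q u (y D2).
        split=> [|z Qz]; first exact: yQ.
        by rewrite (maxy _ _ _ _ TD2 SD2 uE) (maxE _ _ _ _ TD SD c0' uE).
      move=> /sub[_ /(_ (y D') (yQ _ TD'))].
      rewrite (maxy _ _ _ _ TD' S'D' eE) dotC eE.
      exact: rays_positive_sum TD' TD2 S'D' c'0.
    (* A ray of [S'] outside [S] could be exchanged out of [D] while keeping [S], against [K]. *)
    have S'S : S' \subset S.
      apply/subsetP => i iS'; apply/negPn/negP => iS.
      have iD : i \in D by apply: (subsetP (K D TD SD)).
      have [D2 [TD2 /subsetP DD2 iD2]] := flipD TD iD.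
      have /subsetP/(_ i iS') : S' \subset D2.
        apply: K => //; apply/subsetP => j jS; apply: DD2.
        by rewrite in_setD1 SD' // andbT; apply: contraNneq iS => <-.
      by rewrite (negPf iD2).
    apply: subcone_mono S'S _ _; exists (fun i => if i \in S' then c' i else 0).
    split=> [i|]; first by case: ifP => // /c'0/ltW.
    by rewrite eE; apply: eq_bigr => i ->.
  case=> c' [c'0 eE] x [Qx xmax]; split=> // z Qz.
  (* As the coefficients of [u] are positive, a point maximizing [u] is tight on every ray of
     [S]. *)
  have xw i : i \in S -> dot x (v i) = w i.
    have xle j : j \in S -> dot x (v j) <= w j.
      move=> jS; rewrite dotC; apply: Qle Qx => D' TD'.
      by rewrite dotC (y_le TD' TD) ?SD'.
    have := xmax _ (yQ _ TD); rewrite (maxy _ _ _ _ TD SD uE) dotC uE dot_sumr.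
    have : \sum_(j in S) c j * dot x (v j) <= \sum_(j in S) c j * w j.
      by apply: ler_sum => j jS; rewrite ler_wpM2l ?c0' // xle.
    move=> le1 le2; have : \sum_(j in S) c j * (w j - dot x (v j)) = 0.
      rewrite (eq_bigr _ (fun i _ => mulrBr _ _ _)) sumrB; apply/eqP.
      by rewrite subr_eq0 eq_le le1 le2.
    move/psumr_eq0P => H iS; have /eqP : c i * (w i - dot x (v i)) = 0.
      by apply: H => // j jS; rewrite mulr_ge0 ?c0' // subr_ge0 xle.
    by rewrite mulf_eq0 gt_eqF ?c0 //= subr_eq0 => /eqP.
  have -> : dot e x = \sum_(i in S) c' i * w i.
    by rewrite dotC eE dot_sumr; apply: eq_bigr => i iS; rewrite xw.
  exact: (maxE _ _ _ _ TD SD (fun i _ => c'0 i) eE).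
apply/seteqP; split=> [N [u ->]|C [D [S [TD SD ->]]]].
  have [D [S [c [TD SD c0 uE]]]] := complete u.
  by exists D, S; split=> //; exact: (NE _ _ _ _ TD SD c0 uE).
(* A point in the relative interior of the cone. *)
exists (\sum_(i in S) 1 *: v i).
by rewrite (NE D S (fun=> 1) _ TD SD (fun _ _ => ltr01) erefl).
Qed.

End Heights.
End AbstractFan.

(** * The fan of crossing vectors *)

Section SantosVectors.
Variables (R : realType) (n : nat).
Local Notation vertex := 'I_n.+3.
Variable T : 'I_n -> {set vertex}.
Hypothesis Tinj : injective T.
Hypothesis trT : triset (T @: [set: 'I_n]).

Definition svec (d : {set vertex}) : 'rV[R]_n := \row_i (chi T d i)%:~R.

Definition height (d : {set vertex}) : R := (omega T d)%:R.

Lemma svec_dependence (a b c d : vertex) : cyc4 a b c d ->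
  exists x y s t u v : nat, [/\ (0 < x)%N, (0 < y)%N,
    svec [set a; c] *+ x + svec [set b; d] *+ y =
      svec [set a; b] *+ s + svec [set b; c] *+ t + svec [set c; d] *+ u
      + svec [set d; a] *+ v &
    height [set a; b] *+ s + height [set b; c] *+ t + height [set c; d] *+ u
      + height [set d; a] *+ v < height [set a; c] *+ x + height [set b; d] *+ y].
Proof using Tinj trT.
case/(dependence_exists Tinj trT)=> x [y [s [t [u [v [x0 y0 E L]]]]]].
exists x, y, s, t, u, v; split=> //.
  apply/rowP => i; have := congr1 (intmul (1 : R)) (E i).
  by rewrite !mxE !mulmxnE !mxE !rmorphD /= !rmorphMn.
by rewrite /height -!mulrnA -!natrD ltr_nat; lia.
Qed.

Lemma svec_side (p q : vertex) : is_side [set p; q] -> svec [set p; q] = 0.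
Proof using trT.
by move=> sd; apply/rowP => i; rewrite !mxE chi_side.
Qed.

Lemma height_side (p q : vertex) : is_side [set p; q] -> height [set p; q] = 0.
Proof using trT.
move=> sd; rewrite /height omegaE -is_sideE sd ifN //; apply/inTP => -[i E].
have : is_diagonal (T i) by apply: (triset_diag trT); apply: imset_f.
by rewrite E is_diagonalE -is_sideE sd andbF.
Qed.

Lemma svec_T i : svec (T i) = - delta_mx 0 i.
Proof using Tinj trT.
by apply/rowP => j; rewrite !mxE eqxx chi_T // rmorphN /= rmorph_nat.
Qed.

Section Basis.
Variable D : {set {set vertex}}.
Hypothesis tD : triset D.

Definition ray_mx : 'M[R]_(#|D|, n) := \matrix_(k < #|D|) svec (enum_val k).

Lemma ray_mxP d : d \in D -> (svec d <= ray_mx)%MS.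
Proof.
move=> dD; have := row_sub (enum_rank_in dD d) ray_mx.
by rewrite rowK enum_rankK_in.
Qed.

(** Induction along [chord_ind]: the dependence of the quadrilateral [paqb] is solved for the vector
    of [pq], whose coefficient [x] is nonzero. *)
Lemma svec_sub (p q : vertex) : p != q -> (svec [set p; q] <= ray_mx)%MS.
Proof using Tinj trT tD.
move: p q; apply: (chord_ind tD) => [p q /orP[sd|/ray_mxP//]|p a q b cy abD pa aq qb bp _].
  by rewrite svec_side // sub0mx.
have [x [y [s [t [u [v [x0 y0 E _]]]]]]] := svec_dependence cy.
have M e m : (svec e <= ray_mx)%MS -> (svec e *+ m <= ray_mx)%MS.
  by rewrite -scaler_nat; apply: scalemx_sub.
have {}E : svec [set p; q] *+ x = svec [set p; a] *+ s + svec [set a; q] *+ t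
    + svec [set q; b] *+ u + svec [set b; p] *+ v - svec [set a; b] *+ y.
  by rewrite -E addrK.
have H : (svec [set p; q] *+ x <= ray_mx)%MS.
  rewrite E; do ![apply: addmx_sub]; try exact: M.
  by rewrite eqmx_opp; apply: M; apply: ray_mxP.
have xu : (x%:R : R) != 0 by rewrite pnatr_eq0 -lt0n.
by rewrite -[svec _](scalerK xu) scaler_nat scalemx_sub.
Qed.

Lemma ray_mx_full : row_full ray_mx.
Proof using Tinj trT tD.
rewrite -sub1mx; apply/row_subP => i; rewrite row1.
have [r [s [rs E]]] := chord_ends trT i.
rewrite -[delta_mx 0 i]opprK -svec_T E eqmx_opp svec_sub //.
by rewrite -val_eqE /=; lia.
Qed.

Lemma ray_mx_free : row_free ray_mx.
Proof using Tinj trT tD.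
rewrite /row_free (eqP ray_mx_full); case/andP: tD => _ /eqP->.
exact: eqxx.
Qed.

Lemma svec_span (x : 'rV[R]_n) : exists c, x = \sum_(d in D) c d *: svec d.
Proof using Tinj trT tD.
have /submxP[u ->] : (x <= ray_mx)%MS by apply: submx_full ray_mx_full.
exists (fun d => \sum_(k | enum_val k == d :> {set vertex}) u 0 k).
rewrite mulmx_sum_row [RHS]big_enum_val /=; apply: eq_bigr => k _.
rewrite rowK; congr (_ *: _); rewrite (big_pred1 k) // => l /=.
exact: (inj_eq enum_val_inj).
Qed.

Lemma svec_dual (f : {set vertex} -> R) :
  exists y, forall d, d \in D -> dot y (svec d) = f d.
Proof using Tinj trT tD.
have [B MB] := row_freeP ray_mx_free.
pose F : 'cV[R]_#|D| := \col_k f (enum_val k).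
have E : ray_mx *m (B *m F) = F by rewrite mulmxA MB mul1mx.
exists (B *m F)^T => d dD; have := congr1 (fun M : 'cV_#|D| => M (enum_rank_in dD d) 0) E.
rewrite [F _ _]mxE enum_rankK_in // => <-; rewrite mxE; apply: eq_bigr => i _.
by rewrite [_^T _ _]mxE [ray_mx _ _]mxE enum_rankK_in // mulrC.
Qed.

(** Same induction as for [svec_sub]: in the dependence of [paqb] the heights favour the diagonals
    strictly, while [y] is exact on [ab] and at most the height on the four sides. *)
Lemma svec_sep y : (forall d, d \in D -> dot y (svec d) = height d) ->
  forall p q : vertex, p != q -> ~~ edge D p q ->
  dot y (svec [set p; q]) < height [set p; q].
Proof using Tinj trT tD.
move=> yE.
have edgeE (p q : vertex) : edge D p q -> dot y (svec [set p; q]) = height [set p; q].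
  by case/orP=> [sd|/yE//]; rewrite svec_side // height_side // dot0r.
(* The weak inequality is carried along because the four smaller chords may be edges of [D], where
   equality holds. *)
suff H (p q : vertex) : p != q -> (~~ edge D p q ->
   dot y (svec [set p; q]) < height [set p; q]) /\
   dot y (svec [set p; q]) <= height [set p; q].
  by move=> p q pq; apply: (H p q pq).1.
move: p q; apply: (chord_ind tD) => [p q e|p a q b cy abD [_ pa] [_ aq] [_ qb] [_ bp] _].
  by rewrite e edgeE.
suff lt : dot y (svec [set p; q]) < height [set p; q] by split=> //; apply: ltW.
have [x [y' [s [t [u [v [x0 y0 E L]]]]]]] := svec_dependence cy.
have dotMn e m : dot y (svec e *+ m) = dot y (svec e) *+ m.
  by rewrite -scaler_nat dotZr mulr_natl.
rewrite -(ltr_pMn2r x0) -(ltrD2r (height [set a; b] *+ y')).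
apply: le_lt_trans L.
move/(congr1 (dot y)): E; rewrite !dotDr !dotMn (yE _ abD) => ->.
by rewrite !lerD // lerMn2r ?pa ?aq ?qb ?bp orbT.
Qed.

End Basis.

Lemma triset_sep D y : triset D -> (forall d, d \in D -> dot y (svec d) = height d) ->
  forall D' d, triset D' -> d \in D' -> d \notin D -> dot y (svec d) < height d.
Proof using Tinj trT.
move=> tD yE D' d tD' dD'; have := triset_diag tD' dD'.
case/is_diagonalP=> p [q [pq E sd]]; rewrite E => dD; apply: (svec_sep tD yE).
  by rewrite -val_eqE /=; lia.
by rewrite /edge is_sideE (negPf sd).
Qed.

Lemma triset_exchange D d : triset D -> d \in D ->
  exists D' : {set {set vertex}}, [/\ triset D', D :\ d \subset D' & d \notin D'].
Proof.
move=> tD dD; have [a [c [_ E _]]] := is_diagonalP (triset_diag tD dD).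
rewrite E in dD *; have [b [x Q]] := diagonal_quad tD dD.
exists (flip D a b c x); split; first exact: triset_flip.
  exact: subsetUr.
rewrite in_setU1 in_setD1 eqxx /= orbF; apply/eqP => F.
by have := quad_diag_notin tD dD Q; rewrite -F dD.
Qed.

Lemma svec_fan : complete_simplicial_fan (subcones svec (@triset n)) /\
  exists Q, is_polytope Q /\ normal_fan Q = subcones svec (@triset n).
Proof using Tinj trT.
have [y yE] := heights_exist height svec_dual.
split.
  exact: (subcones_fan svec_dual svec_span triset_sep triset_exchange trT yE).
exact: (normal_fan_subcones svec_span triset_sep triset_exchange trT yE).
Qed.

End SantosVectors.

(** * Crossings in a convex polygon *)

Section Geometry.
Variables (R : realType) (n : nat).
Local Notation vertex := 'I_n.+3.
Variable P : vertex -> 'rV[R]_2.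
Hypothesis hP : convex_polygon P.
Implicit Types (p q r s : vertex) (x y z : 'rV[R]_2).

Lemma orient_affine x y z t (a : R) :
  orient x y ((1 - a) *: z + a *: t) = (1 - a) * orient x y z + a * orient x y t.
Proof. by rewrite /orient !mxE; ring. Qed.

Lemma orient_cyc x y z : orient x y z = orient y z x.
Proof. by rewrite /orient; ring. Qed.

Lemma orient_opp x y z : orient x y z = - orient x z y.
Proof. by rewrite /orient; ring. Qed.

Lemma orient_start x y : orient x y x = 0.
Proof. by rewrite /orient; ring. Qed.

Lemma orient_end x y : orient x y y = 0.
Proof. by rewrite /orient; ring. Qed.

Lemma side_of_line r s p : (r < s)%N -> p != r -> p != s ->
  if inarc r s p then orient (P r) (P s) (P p) < 0
  else 0 < orient (P r) (P s) (P p).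
Proof using hP.
move=> rs; rewrite -!val_eqE /= => pr ps.
have -> : inarc r s p = (r < p < s)%N by rewrite /inarc; lia.
case: (ltngtP r p) pr => //= rp _; last by rewrite -orient_cyc; apply: hP.
case: (ltngtP p s) ps => //= sp _; last by apply: hP.
by rewrite orient_opp oppr_lt0; apply: hP.
Qed.

Lemma in_interiorP p q y : p != q -> in_interior P [set p; q] y <->
  exists a : R, [/\ 0 < a, a < 1 & y = (1 - a) *: P p + a *: P q].
Proof.
move=> pq; split=> [[p' [q' [_ /eqP]]]|[a H]]; last first.
  by exists p, q; split=> //; exists a.
rewrite set2_eq => /orP[]/andP[/eqP/val_inj-> /eqP/val_inj->] [a [a0 a1 ->]].
  by exists a; split.
exists (1 - a); rewrite subr_gt0 ltrBlDr ltrDl; split=> //.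
by rewrite opprB addrC subrKC addrC.
Qed.

(** The affine function [orient z t] vanishes on the line [zt], so the left side is where the line
    [xy] meets it; the right side is the same point by symmetry. *)
Lemma intersection_point x y z t :
  let f := orient z t x in let f' := orient z t y in
  let g := orient x y z in let g' := orient x y t in
  f - f' != 0 -> g - g' != 0 ->
  (1 - f / (f - f')) *: x + (f / (f - f')) *: y =
  (1 - g / (g - g')) *: z + (g / (g - g')) *: t.
Proof.
rewrite /orient /= => nf ng; apply/rowP => i; rewrite !mxE.
have [->|->] : i = 0 \/ i = 1.
  by case: i => -[|[|]] // h; [left|right]; apply: val_inj.
  by field; rewrite nf ng.
by field; rewrite nf ng.
Qed.

(** The affine function [orient (P r) (P s)] vanishes along [rs], while [p] and [q] lie weakly on
    one side of that line and not both on it; so it is nonzero inside [pq]. *)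
Lemma crosses_sep p q r s : (r < s)%N -> p != q ->
  [set p; q] != [set r; s] -> ~~ crossn p q r s -> ~ crosses P [set p; q] [set r; s].
Proof using hP.
move=> rs pq dne nX [_ [y []]].
move=> /(in_interiorP _ pq)[a [a0 a1 yE]].
have rsn : r != s by rewrite -val_eqE /= ltn_eqF.
move=> /(in_interiorP _ rsn)[b [b0 b1 yE']].
have : orient (P r) (P s) y = 0.
  by rewrite yE' orient_affine orient_start orient_end !mulr0 addr0.
have a1' : 0 < 1 - a by rewrite subr_gt0.
rewrite yE orient_affine; apply/eqP.
have [pr|pr] := boolP ((p == r) || (p == s)).
  have -> : orient (P r) (P s) (P p) = 0.
    by case/orP: pr => /eqP->; rewrite ?orient_start ?orient_end.
  have [qr qs] : q != r /\ q != s.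
    move: pr pq dne; rewrite set2_eq /eqp -!val_eqE /=; lia.
  rewrite mulr0 add0r mulf_neq0 ?(gt_eqF a0) //.
  have := side_of_line rs qr qs.
  by case: ifP => _ h; rewrite ?(lt_eqF h) ?(gt_eqF h).
rewrite negb_or in pr; case/andP: pr => pr ps.
have [qr|qr] := boolP ((q == r) || (q == s)).
  have -> : orient (P r) (P s) (P q) = 0.
    by case/orP: qr => /eqP->; rewrite ?orient_start ?orient_end.
  rewrite mulr0 addr0 mulf_neq0 ?(gt_eqF a1') //.
  have := side_of_line rs pr ps.
  by case: ifP => _ h; rewrite ?(lt_eqF h) ?(gt_eqF h).
rewrite negb_or in qr; case/andP: qr => qr qs.
have := side_of_line rs pr ps; have := side_of_line rs qr qs.
have -> : inarc r s q = inarc r s p.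
  move: nX; rewrite crossnC /crossn !(inj_eq val_inj) pr ps qr qs /= negbK.
  by move/eqP.
case: ifP => _ h1 h2.
  by rewrite lt_eqF // -oppr_gt0 opprD addr_gt0 // -mulrN mulr_gt0 // oppr_gt0.
by rewrite gt_eqF // addr_gt0 // mulr_gt0.
Qed.

(** Each segment has its ends on opposite sides of the line through the other, so both parameters in
    [intersection_point] lie strictly between 0 and 1. *)
Lemma crosses_cross p q r s : (p < q)%N -> (r < s)%N -> crossn p q r s ->
  crosses P [set p; q] [set r; s].
Proof using hP.
move=> pq rs X.
have [[rp rq] [sp sq] di] : [/\ r != p /\ r != q, s != p /\ s != q &
    inarc p q r != inarc p q s].
  by move: X; rewrite /crossn -!val_eqE => /and5P[*].
have di' : inarc r s p != inarc r s q.
  by move: X; rewrite crossnC /crossn => /and5P[].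
split.
  by apply/eqP; rewrite set2_eq /eqp; move: rp rq; rewrite -!val_eqE /=; lia.
have fp := side_of_line rs (p := p); have fq := side_of_line rs (p := q).
have gr := side_of_line pq (p := r); have gs := side_of_line pq (p := s).
rewrite !(eq_sym p) in fp; rewrite !(eq_sym q) in fq.
have {fp}fp := fp rp sp; have {fq}fq := fq rq sq.
have {gr}gr := gr rp rq; have {gs}gs := gs sp sq.
have ratio (u v : R) : (0 < u) && (v < 0) || (u < 0) && (0 < v) ->
    [/\ u - v != 0, 0 < u / (u - v) & u / (u - v) < 1].
  case/orP=> /andP[h k].
    have h' : 0 < u - v by rewrite subr_gt0 (lt_trans k).
    rewrite gt_eqF // divr_gt0 // ltr_pdivrMr // mul1r ltrDl oppr_gt0; split=> //.
  have h' : u - v < 0 by rewrite subr_lt0 (lt_trans h).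
  by rewrite lt_eqF // nmulr_rgt0 ?invr_lt0 // ltr_ndivrMr // mul1r gtrDl oppr_lt0.
set f := orient (P r) (P s) (P p) in fp; set f' := orient (P r) (P s) (P q) in fq.
set g := orient (P p) (P q) (P r) in gr; set g' := orient (P p) (P q) (P s) in gs.
have [nf f0 f1] : [/\ f - f' != 0, 0 < f / (f - f') & f / (f - f') < 1].
  apply: ratio; move: di' fp fq.
  by case: (inarc r s p); case: (inarc r s q) => // _ -> ->; rewrite ?orbT.
have [ng g0 g1] : [/\ g - g' != 0, 0 < g / (g - g') & g / (g - g') < 1].
  apply: ratio; move: di gr gs.
  by case: (inarc p q r); case: (inarc p q s) => // _ -> ->; rewrite ?orbT.
have pqn : p != q by rewrite -val_eqE /= ltn_eqF.
have rsn : r != s by rewrite -val_eqE /= ltn_eqF.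
exists ((1 - f / (f - f')) *: P p + (f / (f - f')) *: P q); split.
  by apply/(in_interiorP _ pqn); exists (f / (f - f')).
apply/(in_interiorP _ rsn); exists (g / (g - g')); split=> //.
exact: intersection_point.
Qed.

Lemma crossesE p q r s : p != q -> r != s ->
  crosses P [set p; q] [set r; s] <-> crossn p q r s.
Proof using hP.
wlog pq : p q / (p < q)%N.
  move=> W pq rs; case: (ltngtP p q) => [lt|gt|e]; first exact: W.
    by rewrite setUC -crossn_sym; apply: W; rewrite // eq_sym.
  by move: pq; rewrite -val_eqE /= e eqxx.
wlog rs : r s / (r < s)%N.
  move=> W pqn rsn; case: (ltngtP r s) => [lt|gt|e]; first exact: W.
    by rewrite (setUC [set r]) -crossn_symr; apply: W; rewrite // eq_sym.
  by move: rsn; rewrite -val_eqE /= e eqxx.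
move=> pqn rsn; split=> [X|]; last exact: crosses_cross.
have [//|nX] := boolP (crossn p q r s); exfalso.
have dne : [set p; q] != [set r; s] by apply/eqP => E; case: X.
by case: (crosses_sep rs pqn dne nX).
Qed.

Lemma crosses_xing d e : is_diagonal d -> is_diagonal e ->
  crosses P d e <-> xing d e.
Proof using hP.
move=> /is_diagonalP[p [q [pq -> _]]] /is_diagonalP[r [s [rs -> _]]].
by rewrite xingE; apply: crossesE; rewrite -val_eqE /=; lia.
Qed.

Lemma triangulationP (T : 'I_n -> {set vertex}) : triangulation P T <->
  injective T /\ triset (T @: [set: 'I_n]).
Proof using hP.
split=> [[Td Ti Tx]|[Ti tT]].
  split=> //; apply/andP; split; last by rewrite card_imset // cardsT card_ord.
  apply/noncrossingP; split=> [d /imsetP[i _ ->]//|].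
  move=> d e /imsetP[i _ ->] /imsetP[j _ ->].
  by apply/negP => /(crosses_xing (Td i) (Td j)); apply: Tx.
have Td i : is_diagonal (T i) by apply: (triset_diag tT); apply: imset_f.
split=> // i j /(crosses_xing (Td i) (Td j)); apply/negP.
by apply: (triset_nc tT); apply: imset_f.
Qed.

Lemma santos_vectorE (T : 'I_n -> {set vertex}) d : injective T ->
  triset (T @: [set: 'I_n]) -> is_diagonal d -> santos_vector P T d = svec R T d.
Proof using hP.
move=> Ti tT dd; rewrite /santos_vector; case: pickP => [i /eqP<-|H].
  by rewrite svec_T.
apply/rowP => j; rewrite summxE !mxE chi_def H.
have Td : is_diagonal (T j) by apply: (triset_diag tT); apply: imset_f.
rewrite big_mkcond (bigD1 j) //= big1 ?addr0 => [|i ij].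
  rewrite mxE !eqxx /=.
  have -> : `[< crosses P d (T j) >] = xing d (T j).
    by apply/asboolP/idP => /(crosses_xing dd Td).
  by case: xing.
by case: ifP => //; rewrite mxE eqxx eq_sym (negPf ij).
Qed.

End Geometry.

(** * Cones over reindexed families of vectors *)

Section ConeImage.
Variables (R : realType) (n : nat) (I J : finType).
Variables (f : I -> J) (g : J -> 'rV[R]_n).
Hypothesis f_inj : injective f.

Lemma cone_imset (S : {set I}) :
  cone (fun i => g (f i)) (fun i => i \in S) = cone g (fun j => j \in f @: S).
Proof using f_inj.
apply/seteqP; split=> x [c [c0 ->]]; last first.
  by exists (fun i => c (f i)); split=> //; rewrite big_imset //; apply: in2W.
exists (fun j => \sum_(i | f i == j) c i); split=> [j|]; first exact: sumr_ge0.
rewrite [RHS]big_imset /=; last by apply: in2W.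
apply: eq_bigr => i _; congr (_ *: _); rewrite (big_pred1 i) // => k /=.
exact: (inj_eq f_inj).
Qed.

Lemma cone_predT :
  cone (fun i => g (f i)) predT = cone g (fun j => j \in f @: [set: I]).
Proof using f_inj.
rewrite -cone_imset; apply/seteqP; split=> x [c [c0 ->]]; exists c; split=> //;
  by apply: eq_bigl => i; rewrite in_setT.
Qed.

End ConeImage.

(** * Denominators of positive Laurent polynomials *)

Section Denominators.
Variable n : nat.
Local Notation K := (ambient n).
Local Notation poly := {mpoly int[n]}.
Implicit Types (z : K) (N : poly) (d e : 'I_n -> int).

Definition var (i : 'I_n) : K := tofrac ('X_i : poly).

Definition mono d : K := \prod_(i < n) var i ^ d i.

Definition axis (i : 'I_n) : 'I_n -> int := fun j => (j != i)%:R.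

Lemma var_neq0 i : var i != 0.
Proof.
rewrite /var tofrac_eq0; apply/eqP => /(congr1 (meval (fun=> 1))).
by rewrite mevalXU meval0 => /eqP; rewrite oner_eq0.
Qed.

Lemma mono_neq0 d : mono d != 0.
Proof. by apply/prodf_neq0 => i _; rewrite expfz_neq0 ?var_neq0. Qed.

Lemma monoD d e : mono (fun i => d i + e i) = mono d * mono e.
Proof. by rewrite /mono -big_split; apply: eq_bigr => i _; rewrite expfzDr ?var_neq0. Qed.

Lemma mono_ext d e : d =1 e -> mono d = mono e.
Proof. by move=> E; apply: eq_bigr => i _; rewrite E. Qed.

Lemma mono_nonneg (g : 'I_n -> int) : (forall i, 0 <= g i) ->
  tofrac ('X_[[multinom absz (g i) | i < n]] : poly) = mono g.
Proof.
move=> g0; rewrite mpolyXE_id rmorph_prod; apply: eq_bigr => i _.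
by rewrite rmorphXn /= mnmE -[in RHS](gez0_abs (g0 i)).
Qed.

(** Positivity at [axis i] certifies that ['X_i] does not divide the numerator and, unlike
    non-divisibility, survives products and sums. *)
Definition pos_laurent z d : Prop :=
  exists N, (forall i, 0 < N.@[axis i]) /\ z = tofrac N / mono d.

Lemma pos_laurentM z z' d d' : pos_laurent z d -> pos_laurent z' d' ->
  pos_laurent (z * z') (fun i => d i + d' i).
Proof.
case=> N [N0 ->] [N' [N'0 ->]]; exists (N * N'); split.
  by move=> i; rewrite mevalM mulr_gt0.
by rewrite rmorphM monoD invfM mulrACA.
Qed.

Lemma meval_axisX (m : 'I_n -> nat) i :
  ('X_[[multinom m i | i < n]] : poly).@[axis i] = (m i == 0)%N%:R.
Proof.
rewrite mevalX (bigD1 i) //= big1 => [|j ji]; last first.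
  by rewrite /axis ji expr1n.
by rewrite mulr1 mnmE /axis eqxx expr0n.
Qed.

(** Over the common denominator, each numerator is multiplied by a monomial whose value at [axis i]
    is 0 or 1, and 1 for a summand attaining the maximum at [i]. *)
Lemma pos_laurentD z z' d d' : pos_laurent z d -> pos_laurent z' d' ->
  pos_laurent (z + z') (fun i => Num.max (d i) (d' i)).
Proof.
case=> N [N0 ->] [N' [N'0 ->]].
pose lift (f : 'I_n -> int) : poly :=
  'X_[[multinom absz (Num.max (d i) (d' i) - f i) | i < n]].
have E (f : 'I_n -> int) M : (forall i, f i <= Num.max (d i) (d' i)) ->
    tofrac M / mono f = tofrac (M * lift f) / mono (fun i => Num.max (d i) (d' i)).
  move=> fle; rewrite rmorphM /= mono_nonneg => [|i]; last by rewrite subr_ge0.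
  rewrite (@mono_ext (fun i => Num.max (d i) (d' i))
    (fun i => (Num.max (d i) (d' i) - f i) + f i)); last by move=> i; rewrite subrK.
  by rewrite monoD invfM mulrA mulfK ?mono_neq0.
rewrite (E d N) => [|i]; last by rewrite le_max lexx.
rewrite (E d' N') => [|i]; last by rewrite le_max lexx orbT.
exists (N * lift d + N' * lift d'); split; last by rewrite rmorphD mulrDl.
move=> i; rewrite mevalD !mevalM !meval_axisX.
have [le|lt] := leP (d' i) (d i).
  rewrite subrr mulr1 ltr_wpDr ?N0 // mulr_ge0 ?ler0n //; exact/ltW/N'0.
by rewrite subrr mulr1 ltr_wpDl ?N'0 // mulr_ge0 ?ler0n //; exact/ltW/N0.
Qed.

Lemma pos_laurent_ext z d e : d =1 e -> pos_laurent z d -> pos_laurent z e.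
Proof. by move=> E [N [N0 ->]]; exists N; rewrite (mono_ext E). Qed.

Lemma mono_delta k m : mono (fun i => (i == k)%:R * m) = var k ^ m.
Proof.
rewrite /mono (bigD1 k) //= eqxx mul1r big1 ?mulr1 // => i /negPf->.
by rewrite mul0r expr0z.
Qed.

Lemma pos_laurent_div z d k : pos_laurent z d ->
  pos_laurent (z / var k) (fun i => d i + (i == k)%:R).
Proof.
case=> N [N0 ->]; exists N; split=> //.
rewrite monoD -mulrA -invfM -[var k]expr1z -mono_delta.
by congr (_ / (_ * _)); apply: mono_ext => i; rewrite mulr1.
Qed.

Lemma pos_laurent1 : pos_laurent 1 (fun=> 0).
Proof.
exists 1; split=> [i|]; first by rewrite meval1.
by rewrite rmorph1 /mono big1 ?divr1 // => i _; rewrite expr0z.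
Qed.

Lemma pos_laurent_var k : pos_laurent (var k) (fun i => - (i == k)%:R).
Proof.
exists 1; split=> [i|]; first by rewrite meval1.
rewrite (@mono_ext _ (fun i => (i == k)%:R * -1)) => [|i]; last by rewrite mulrN1.
by rewrite mono_delta exprN1 invrK rmorph1 mul1r.
Qed.

Lemma pos_laurent_denominator z d : pos_laurent z d -> denominator_vector z d.
Proof.
case=> N [N0 E]; exists N; split=> // i [q F].
by have := N0 i; rewrite F mevalM mevalXU /axis eqxx mul0r ltxx.
Qed.

Lemma mnm_var_dvd N (m : 'X_{1..n}) i (q : poly) :
  m i = 0%N -> N * 'X_[m] = 'X_i * q -> exists q', N = 'X_i * q'.
Proof.
move=> mi E.
have supp u : u \in msupp N -> (0 < u i)%N.
  move=> uN; have : (m + u)%MM \in msupp (N * 'X_[m]).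
    by rewrite (perm_mem (msuppMX _ _)); apply/mapP; exists u.
  rewrite E mulrC (perm_mem (msuppMX _ _)) => /mapP[m' _ /mnmP/(_ i)].
  by rewrite !mnmDE mi mnm1E eqxx add0n => ->.
(* Every monomial of [N] contains the i-th variable; the quotient lowers that exponent by one. *)
exists (\sum_(u <- msupp N) N@_u *: 'X_[u - U_(i)]).
rewrite {1}[N]mpolyE mulr_sumr big_seq [RHS]big_seq; apply: eq_bigr => u /supp ui.
rewrite -scalerAr -mpolyXD; congr (_ *: 'X_[_]); apply/mnmP => j.
rewrite mnmDE mnmBE mnm1E; case: eqP => [<-|_]; last by rewrite subn0.
by rewrite subnKC.
Qed.

Lemma denominator_unique z d e : pos_laurent z d -> denominator_vector z e ->
  d =1 e.
Proof.
case=> N [N0 ->] [N' [N'0]]; rewrite -[\prod_(i < n) _]/(mono e) => E.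
pose m (f g : 'I_n -> int) : 'X_{1..n} := [multinom absz (Num.max (f i) (g i) - g i) | i < n].
have mE f g : tofrac ('X_[m f g] : poly) * mono g = mono (fun i => Num.max (f i) (g i)).
  rewrite mono_nonneg => [|i]; last by rewrite subr_ge0 le_max lexx orbT.
  by rewrite -monoD; apply: mono_ext => i; rewrite subrK.
have {}E : N * 'X_[m e d] = N' * 'X_[m d e].
  apply/eqP; rewrite -tofrac_eq !rmorphM /=; apply/eqP.
  have H : tofrac N * mono e = tofrac N' * mono d.
    by apply/eqP; rewrite -eqr_div ?mono_neq0 // E.
  apply: (mulIf (mono_neq0 d)); rewrite -mulrA mE.
  apply: (mulIf (mono_neq0 e)); rewrite -[RHS]mulrA [mono d * _]mulrC.
  rewrite [RHS]mulrA -(mulrA (tofrac N')) mE mulrAC H mulrAC; congr (_ * _ * _).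
  by apply: mono_ext => i; rewrite maxC.
(* If [d i < e i], the i-th variable divides the left side of [E] but not the monomial on the right,
   so it divides [N']. *)
move=> i; case: (ltgtP (d i) (e i)) => // lt.
  case: (N'0 i); apply: (@mnm_var_dvd _ (m d e) i (N * 'X_[m e d - U_(i)])).
    by rewrite mnmE (max_idPr (ltW lt)) subrr.
  rewrite -E mulrCA -mpolyXD; congr (_ * 'X_[_]); apply/mnmP => j.
  rewrite mnmDE mnmBE mnm1E; case: eqP => [<-|_]; last by rewrite subn0.
  rewrite subnKC // mnmE (max_idPl (ltW lt)) lt0n absz_eq0 subr_eq0.
  by rewrite gt_eqF.
(* If [e i < d i], the right side vanishes at [axis i], whereas the monomial on the left is 1 there;
   so [N] would vanish. *)
have := congr1 (meval (axis i)) E.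
rewrite !mevalM !meval_axisX (max_idPr (ltW lt)) (max_idPl (ltW lt)).
rewrite subrr mulr1 [X in _ * X]/= absz_eq0 subr_eq0 gt_eqF // mulr0 => E0.
by have := N0 i; rewrite E0 ltxx.
Qed.

End Denominators.

(** * Solving the Ptolemy relations *)

(* The cluster variable of a chord [pq] is realized as the determinant of two
   vectors of the plane attached to [p] and [q], so that the exchange relations
   become the Pluecker relations. *)
Section PlaneVectors.
Variables (K : fieldType) (n : nat).
Local Notation vertex := 'I_n.+3.
Implicit Types (a b c p q : vertex) (x y z : K * K).

Definition det2 x y : K := x.1 * y.2 - x.2 * y.1.

Lemma det2_solve x y (s t : K) : det2 x y != 0 ->
  exists z, det2 x z = s /\ det2 z y = t.
Proof.
move=> nz; exists ((t * x.1 + s * y.1) / det2 x y, (t * x.2 + s * y.2) / det2 x y).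
by move: nz; rewrite /det2 /= => nz; split; field.
Qed.

Variable D : {set {set vertex}}.
Hypothesis tD : triset D.
Variable val : {set vertex} -> K.
Hypothesis val_neq0 : forall p q, edge D p q -> val [set p; q] != 0.

(** Induction on the length of the interval: in the triangle [acb] the vector at [c] is determined
    by its determinants with those at [a] and [b], and the parts below [ac] and [cb] are treated
    separately. *)
Lemma plane_vectors_interval m a b : (a < b)%N -> (b <= a + m)%N -> edge D a b ->
  forall x y, det2 x y = val [set a; b] ->
  exists u : vertex -> K * K, [/\ u a = x, u b = y &
    forall p q, (a <= p)%N -> (p < q)%N -> (q <= b)%N -> edge D p q ->
      det2 (u p) (u q) = val [set p; q]].
Proof using tD val_neq0.
elim: m a b => [|m IH] a b ab bm eab x y xy; first lia.
have [sab|] := boolP (b == a.+1 :> nat).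
  exists (fun c => if c == a then x else y); split.
  - by rewrite eqxx.
  - by rewrite -val_eqE /= gtn_eqF.
  move=> p q ap pq qb _; have pa : p = a by apply: val_inj => /=; lia.
  have -> : q = b by apply: val_inj => /=; lia.
  by rewrite pa eqxx -val_eqE /= gtn_eqF.
move=> nab; have [|c [acb eac ecb]] := triangle_exists tD eab.
  by rewrite /fwd (ltnW ab); lia.
have [ac cb] : (a < c)%N /\ (c < b)%N by move: acb; rewrite /cyc3; lia.
have [z [xz zy]] := @det2_solve x y (val [set a; c]) (val [set c; b])
  ltac:(by rewrite xy val_neq0).
have [|u [ua uc Hu]] := IH a c ac _ eac x z xz; first lia.
have [|v [vc vb Hv]] := IH c b cb _ ecb z y zy; first lia.
exists (fun p => if (p <= c)%N then u p else v p); split.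
- by rewrite (ltnW ac).
- by rewrite leqNgt cb.
move=> p q ap pq qb epq; case: (leqP q c) => qc.
  by rewrite (leq_trans (ltnW pq)) // Hu.
case: (ltngtP p c) => [pc|cp|/val_inj pc].
(* An edge passing over [c] that crosses neither [ac] nor [cb] is [ab]. *)
- have [pa bq] : p = a /\ q = b.
    have := edge_nc tD epq eac; have := edge_nc tD epq ecb.
    rewrite /crossn /inarc => h1 h2.
    by split; apply: val_inj => /=; clear -h1 h2 ap pq qb pc qc ac cb; lia.
  by rewrite pa bq ua vb xy.
- by rewrite Hv // ltnW.
- by rewrite pc uc -vc Hv // -pc // ltnW.
Qed.

Hypothesis val_side : forall p q, is_side [set p; q] -> val [set p; q] = 1.

Lemma plane_vectors : exists u : vertex -> K * K,
  forall p q, (p < q)%N -> edge D p q -> det2 (u p) (u q) = val [set p; q].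
Proof using tD val_neq0 val_side.
have sd : is_side [set ord0; ord_max : vertex].
  by rewrite is_sideE /siden /= ?eqxx ?orbT.
(* The side from 0 to [n.+2] has value 1, so the standard basis can be attached to its ends. *)
have xy : det2 (1, 0) (0, 1) = val [set ord0; ord_max : vertex].
  by rewrite val_side // /det2 /= mulr0 subr0 mulr1.
have e0 : edge D ord0 ord_max by rewrite /edge sd.
have [//|//|u [_ _ H]] := @plane_vectors_interval n.+2 ord0 ord_max _ _ e0 _ _ xy.
by exists u => p q pq e; apply: H => //; rewrite -ltnS.
Qed.

Lemma chord_values : exists x : {set vertex} -> K,
  (forall p q, edge D p q -> x [set p; q] = val [set p; q]) /\
  (forall a b c d : vertex, cyc4 a b c d ->
     x [set a; c] * x [set b; d] =
     x [set a; b] * x [set c; d] + x [set b; c] * x [set d; a]).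
Proof using tD val_neq0 val_side.
have [u uE] := plane_vectors.
(* As [det2] is antisymmetric, the ends are ordered by label; the Pluecker relation for increasing
   labels then has only plus signs. *)
pose x (d : {set vertex}) : K :=
  if [pick w : vertex * vertex | (w.1 < w.2)%N && (d == [set w.1; w.2])] is Some w
  then det2 (u w.1) (u w.2) else 0.
have xE p q : (p < q)%N -> x [set p; q] = det2 (u p) (u q).
  move=> pq; rewrite /x; case: pickP => [[r s] /= /andP[rs]|/(_ (p, q))]; last first.
    by rewrite /= pq eqxx.
  rewrite set2_eq => /orP[]/andP[/eqP E /eqP F].
    by rewrite (val_inj E) (val_inj F).
  by move: rs; rewrite E F; lia.
have xE' p q : (p < q)%N -> x [set q; p] = det2 (u p) (u q).
  by rewrite setUC; apply: xE.
exists x; split=> [p q e|a b c d].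
  have := edge_neq tD e; rewrite -val_eqE /=; case: (ltngtP p q) => // lt _.
    by rewrite xE // uE.
  by rewrite xE' // uE ?(edgeC _ q) // setUC.
case/or4P=> /andP[/andP[h1 h2] h3]; have h4 := ltn_trans h1 h2;
  have h5 := ltn_trans h2 h3; have h6 := ltn_trans h1 h5;
  rewrite ?(xE _ _ h1, xE' _ _ h1, xE _ _ h2, xE' _ _ h2, xE _ _ h3, xE' _ _ h3);
  rewrite ?(xE _ _ h4, xE' _ _ h4, xE _ _ h5, xE' _ _ h5, xE _ _ h6, xE' _ _ h6);
  rewrite /det2; ring.
Qed.

End PlaneVectors.

(** * Chord variables as Laurent polynomials *)

Section ClusterVariables.
Variables (n : nat) (T : 'I_n -> {set 'I_n.+3}).
Local Notation vertex := 'I_n.+3.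
Hypothesis Tinj : injective T.
Hypothesis trT : triset (T @: [set: 'I_n]).

Definition chord_vars (x : {set vertex} -> ambient n) : Prop :=
  [/\ forall i, x (T i) = var i,
      forall p q : vertex, is_side [set p; q] -> x [set p; q] = 1 &
      forall a b c d : vertex, cyc4 a b c d ->
     x [set a; c] * x [set b; d] =
     x [set a; b] * x [set c; d] + x [set b; c] * x [set d; a]].

Lemma T_nside i (p q : vertex) : is_side [set p; q] -> T i != [set p; q].
Proof using trT.
apply: contraTneq => <-; have : is_diagonal (T i).
  by apply: (triset_diag trT); apply: imset_f.
by case/existsP=> r /existsP[s /and3P[]].
Qed.

Lemma chord_vars_exist : exists x, chord_vars x.
Proof using Tinj trT.
pose val (d : {set vertex}) : ambient n :=
  if [pick i | T i == d] is Some i then var i else 1.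
have valT i : val (T i) = var i.
  rewrite /val; case: pickP => [j /eqP/Tinj->//|/(_ i)].
  by rewrite eqxx.
have valS (p q : vertex) : is_side [set p; q] -> val [set p; q] = 1.
  by move=> sd; rewrite /val; case: pickP => // i; rewrite (negPf (T_nside i sd)).
have [|x [xE xP]] := chord_values trT (val := val) _ valS.
  move=> p q _; rewrite /val; case: pickP => [i _|_]; first exact: var_neq0.
  exact: oner_neq0.
exists x; split=> // [i|p q sd].
  have [r [s [_ E]]] := chord_ends trT i; rewrite E xE -?E ?valT //.
  by rewrite /edge -E imset_f ?orbT.
by rewrite xE ?valS // /edge sd.
Qed.

Variable x : {set vertex} -> ambient n.
Hypothesis xP : chord_vars x.

(** Solving the Ptolemy relation for [pq] divides by the initial variable of [ab]; the exponents
    then follow [tropical_ptolemy]. *)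
Lemma chord_var_laurent (p q : vertex) : p != q ->
  pos_laurent (x [set p; q]) (chi T [set p; q]).
Proof using Tinj trT xP.
have [xT xS xPt] := xP.
move: p q; apply: (chord_ind trT) => [p q|p a q b cy /imsetP[k _ E]].
  case/orP=> [sd|/imsetP[k _ ->]].
    rewrite xS //; apply: (pos_laurent_ext _ (pos_laurent1 n)) => i.
    by rewrite chi_side.
  by rewrite xT; apply: (pos_laurent_ext _ (pos_laurent_var k)) => i; rewrite chi_T.
move=> pa aq qb bp _.
have -> : x [set p; q] =
    (x [set p; a] * x [set q; b] + x [set a; q] * x [set b; p]) / var k.
  by rewrite -xPt // E xT mulfK // var_neq0.
apply: (pos_laurent_ext _ (pos_laurent_div k
  (pos_laurentD (pos_laurentM pa qb) (pos_laurentM aq bp)))) => i /=.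
have [r [s [_ F]]] := chord_ends trT i.
have := tropical_ptolemy r s cy; rewrite -!(chiE _ _ F) E chi_T // => /eqP <-.
by rewrite subrK.
Qed.

(** The index [k] provides a point [axis k] at which the numerator is positive. *)
Lemma chord_var_neq0 (k : 'I_n) (p q : vertex) : p != q -> x [set p; q] != 0.
Proof using Tinj trT xP.
move=> pq; have [N [N0 ->]] := chord_var_laurent pq.
rewrite mulf_neq0 ?invr_neq0 ?mono_neq0 // tofrac_eq0.
by apply: contraTneq (N0 k) => ->; rewrite meval0 ltxx.
Qed.

End ClusterVariables.

(** * Mutation of the signed adjacency matrix *)

Section Adjacency.
Variables (n : nat).
Local Notation vertex := 'I_n.+3.
Implicit Types (a b c p q r : vertex) (i j k : 'I_n).

Definition tri_edge (T : 'I_n -> {set vertex}) p q : bool :=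
  edge (T @: [set: 'I_n]) p q.

Lemma existsT (T : 'I_n -> {set vertex}) d :
  [exists i, T i == d] = (d \in T @: [set: 'I_n]).
Proof.
apply/existsP/imsetP => [[i /eqP<-]|[i _ ->]]; first by exists i.
by exists i.
Qed.

Lemma is_triangleE T p q r : is_triangle T p q r =
  [&& (p < q)%N, (q < r)%N, tri_edge T p q, tri_edge T q r & tri_edge T r p].
Proof. by rewrite /is_triangle /tri_edge /edge !existsT. Qed.

Definition next_side T i j : bool :=
  [exists p, exists q, exists r, is_triangle T p q r && ccw_next T p q r i j].

(** Here the triangle is listed cyclically from the tail of [T i], whereas [is_triangle] requires
    increasing labels. *)
Lemma next_sideP T i j : reflect
  (exists a b c, [/\ cyc3 a b c, T i = [set a; b], T j = [set b; c] & tri_edge T c a])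
  (next_side T i j).
Proof.
have edgeT k p q : T k = [set p; q] -> tri_edge T p q.
  by move=> E; rewrite /tri_edge /edge -E imset_f ?orbT.
apply: (iffP existsP) => [[p /existsP[q /existsP[r]]]|[a [b [c [cy Ti Tj eca]]]]].
  rewrite is_triangleE => /andP[/and5P[pq qr epq eqr erp]].
  case/or3P=> /andP[/eqP Ti /eqP Tj].
  - by exists p, q, r; split=> //; rewrite /cyc3 pq qr.
  - by exists q, r, p; split=> //; rewrite /cyc3 pq qr !orbT.
  - by exists r, p, q; split=> //; rewrite /cyc3 pq qr !orbT.
have eab := edgeT _ _ _ Ti; have ebc := edgeT _ _ _ Tj.
case/or3P: cy => /andP[h1 h2].
- exists a; apply/existsP; exists b; apply/existsP; exists c.
  by rewrite is_triangleE h1 h2 eab ebc eca /ccw_next Ti Tj !eqxx.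
- exists b; apply/existsP; exists c; apply/existsP; exists a.
  by rewrite is_triangleE h1 h2 eab ebc eca /ccw_next Ti Tj !eqxx !orbT.
- exists c; apply/existsP; exists a; apply/existsP; exists b.
  by rewrite is_triangleE h1 h2 eab ebc eca /ccw_next Ti Tj !eqxx !orbT.
Qed.

Lemma ccw_next_inj T p q r p' q' r' i j :
  (p < q)%N && (q < r)%N -> (p' < q')%N && (q' < r')%N ->
  ccw_next T p q r i j -> ccw_next T p' q' r' i j ->
  [/\ p = p', q = q' & r = r'].
Proof.
move=> pqr pqr' /or3P H /or3P H'.
suff : [/\ p = p' :> nat, q = q' :> nat & r = r' :> nat].
  by case=> /val_inj-> /val_inj-> /val_inj->.
by case: H => /andP[/eqP E /eqP F]; case: H' => /andP[]; rewrite E F !set2_eq /eqp;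
  move: pqr pqr'; clear=> *; split; lia.
Qed.

Lemma sum_unique (F : vertex -> vertex -> vertex -> bool) :
  (forall p q r p' q' r', F p q r -> F p' q' r' -> [/\ p = p', q = q' & r = r']) ->
  \sum_p \sum_q \sum_r Posz (F p q r) =
  Posz [exists p, exists q, exists r, F p q r].
Proof.
move=> U; case: (boolP [exists p, _]) => [|H].
  case/existsP=> p /existsP[q /existsP[r Fpqr]].
  rewrite (bigD1 p) //= [X in _ + X]big1 => [|p' pp']; last first.
    rewrite big1 // => q' _; rewrite big1 // => r' _.
    by case: (boolP (F _ _ _)) => // /(U _ _ _ _ _ _ Fpqr)[E]; rewrite E eqxx in pp'.
  rewrite addr0 (bigD1 q) //= [X in _ + X]big1 => [|q' qq']; last first.
    rewrite big1 // => r' _.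
    by case: (boolP (F _ _ _)) => // /(U _ _ _ _ _ _ Fpqr)[_ E]; rewrite E eqxx in qq'.
  rewrite addr0 (bigD1 r) //= [X in _ + X]big1 => [|r' rr']; last first.
    by case: (boolP (F _ _ _)) => // /(U _ _ _ _ _ _ Fpqr)[_ _ E]; rewrite E eqxx in rr'.
  by rewrite addr0 Fpqr.
rewrite big1 // => p _; rewrite big1 // => q _; rewrite big1 // => r _.
move: H; rewrite negb_exists => /forallP/(_ p); rewrite negb_exists => /forallP/(_ q).
by rewrite negb_exists => /forallP/(_ r)/negPf->.
Qed.

(** Two consecutive sides determine their triangle ([ccw_next_inj]), so each of the two sums has at
    most one nonzero term. *)
Lemma adjacencyE T i j :
  adjacency T i j = Posz (next_side T j i) - Posz (next_side T i j).
Proof.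
have S k l : \sum_p \sum_q \sum_(r | is_triangle T p q r) Posz (ccw_next T p q r k l)
    = Posz (next_side T k l).
  rewrite -sum_unique => [|p q r p' q' r']; last first.
    rewrite !is_triangleE => /andP[/and5P[h1 h2 _ _ _] h3].
    case/andP=> /and5P[h4 h5 _ _ _] h6.
    by apply: ccw_next_inj h3 h6; rewrite ?h1 ?h4.
  apply: eq_bigr => p _; apply: eq_bigr => q _; rewrite big_mkcond.
  by apply: eq_bigr => r _; case: is_triangle.
rewrite mxE -!S -sumrB; apply: eq_bigr => p _.
by rewrite -sumrB; apply: eq_bigr => q _; rewrite -sumrB.
Qed.

End Adjacency.

(** * Triangles around the flipped diagonal *)

Section FlipSides.
Variables (n : nat) (T : 'I_n -> {set 'I_n.+3}).
Local Notation vertex := 'I_n.+3.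
Hypothesis Tinj : injective T.
Hypothesis trT : triset (T @: [set: 'I_n]).
Variables (k : 'I_n) (a b c d : vertex).
Hypothesis Tk : T k = [set a; c].
Hypothesis Q : quad (T @: [set: 'I_n]) a b c d.
Implicit Types (i j l : 'I_n) (p q r x y : vertex).

Lemma quad_apex_d x : cyc3 a c x -> tri_edge T a x -> tri_edge T c x -> x = d.
Proof using trT Q.
case: Q => cy [eab ebc ecd eda] cyx eax ecx; apply: val_inj.
exact: apex_unique cy cyx (edge_nc trT eax ecd) (edge_nc trT ecx eda).
Qed.

Lemma quad_apex_b x : cyc3 c a x -> tri_edge T c x -> tri_edge T a x -> x = b.
Proof using trT Q.
case: (quad_rot (quad_rot Q)) => cy [ecd eda eab ebc] cyx ecx eax; apply: val_inj.
exact: apex_unique cy cyx (edge_nc trT ecx eab) (edge_nc trT eax ebc).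
Qed.

Lemma tri_edge_T i p q : T i = [set p; q] -> tri_edge T p q.
Proof. by move=> E; rewrite /tri_edge /edge -E imset_f ?orbT. Qed.

Lemma tri_edgeC p q : tri_edge T p q = tri_edge T q p.
Proof. exact: edgeC. Qed.

Let cac : tri_edge T c a.
Proof. by rewrite tri_edgeC; apply: tri_edge_T Tk. Qed.

Let cyacd : cyc3 a c d.
Proof. by case: Q => + _; rewrite /cyc4 /cyc3; lia. Qed.

Let cycab : cyc3 c a b.
Proof. by case: Q => + _; rewrite /cyc4 /cyc3; lia. Qed.

Lemma cyc3_rot p q r : cyc3 p q r -> cyc3 q r p.
Proof. by rewrite /cyc3; lia. Qed.

Lemma next_of_diagonal j :
  next_side T k j = (T j == [set a; b]) || (T j == [set c; d]).
Proof using trT Tk Q.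
have [_ [eab ebc ecd eda]] := Q.
apply/next_sideP/orP => [[p [q [r [cy Ti Tj erp]]]]|[] /eqP Tj].
- move: Ti => /eqP; rewrite Tk set2_eq => /orP[]/andP[/eqP/val_inj E /eqP/val_inj F].
    subst p q; right; rewrite Tj (quad_apex_d cy) //; first by rewrite tri_edgeC.
    exact: tri_edge_T Tj.
  subst p q; left; rewrite Tj (quad_apex_b cy) //; first by rewrite tri_edgeC.
  exact: tri_edge_T Tj.
- by exists c, a, b; split=> //; rewrite Tk setUC.
- by exists a, c, d; split=> //; rewrite Tk.
Qed.

Lemma next_to_diagonal j :
  next_side T j k = (T j == [set b; c]) || (T j == [set d; a]).
Proof using trT Tk Q.
have [_ [eab ebc ecd eda]] := Q.
apply/next_sideP/orP => [[p [q [r [cy Tj Ti erp]]]]|[] /eqP Tj].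
- move: Ti => /eqP; rewrite Tk set2_eq => /orP[]/andP[/eqP/val_inj E /eqP/val_inj F].
    subst q r; right; rewrite Tj (quad_apex_d (cyc3_rot cy)) //.
    by rewrite tri_edgeC; apply: tri_edge_T Tj.
  subst q r; left; rewrite Tj (quad_apex_b (cyc3_rot cy)) //.
  by rewrite tri_edgeC; apply: tri_edge_T Tj.
- exists b, c, a; split=> //; first by apply/cyc3_rot/cyc3_rot.
    by rewrite Tk setUC.
- by exists d, a, c; split=> //; apply/cyc3_rot/cyc3_rot.
Qed.

(** The third side of the triangle is required not to be the k-th diagonal; for [i], [j] other than
    [k] such a triangle survives the flip. *)
Definition next_away (S : 'I_n -> {set vertex}) i j : bool :=
  [exists p : vertex, exists q : vertex, exists r : vertex,
    [&& cyc3 p q r, S i == [set p; q],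
    S j == [set q; r] &
    is_side [set r; p] || [exists l, (l != k) && (S l == [set r; p])]]].

Lemma next_awayE i j : next_side T i j = [|| next_away T i j,
  (T i == [set a; b]) && (T j == [set b; c]) |
  (T i == [set c; d]) && (T j == [set d; a])].
Proof using trT Tk Q.
have [_ [eab ebc ecd eda]] := Q.
apply/next_sideP/or3P => [[p [q [r [cy Ti Tj erp]]]]|].
  have [E|ne] := eqVneq (T k) [set r; p].
    have epq := tri_edge_T Ti; have eqr := tri_edge_T Tj.
    move/eqP: E; rewrite Tk set2_eq => /orP[]/andP[/eqP/val_inj E /eqP/val_inj F].
      subst r p; apply: Or33; have qd : q = d.
        by apply: quad_apex_d (cyc3_rot (cyc3_rot cy)) _ _; rewrite // tri_edgeC.
      by rewrite Ti Tj qd !eqxx.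
    subst r p; apply: Or32; have qb : q = b.
      by apply: quad_apex_b (cyc3_rot (cyc3_rot cy)) _ _; rewrite // tri_edgeC.
    by rewrite Ti Tj qb !eqxx.
  apply: Or31; apply/existsP; exists p; apply/existsP; exists q; apply/existsP; exists r.
  rewrite cy Ti Tj !eqxx /=; case/orP: erp => [->//|/imsetP[l _ E]].
  apply/orP; right; apply/existsP; exists l; rewrite E eqxx andbT.
  by apply: contraNneq ne => <-; rewrite E.
case=> [/existsP[p /existsP[q /existsP[r /and4P[cy /eqP Ti /eqP Tj e]]]]|
    /andP[/eqP Ti /eqP Tj]|/andP[/eqP Ti /eqP Tj]].
- exists p, q, r; split=> //; case/orP: e => [sd|/existsP[l /andP[_ /eqP E]]].
    by rewrite /tri_edge /edge sd.
  exact: tri_edge_T E.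
- by exists a, b, c; split=> //; apply: cyc3_rot.
- by exists c, d, a; split=> //; [apply: cyc3_rot | rewrite tri_edgeC].
Qed.

(** Makes the alternatives in [next_awayE] disjoint, as [mutation_bits] requires: two consecutive
    sides determine the third. *)
Lemma next_away_excl i j : next_away T i j ->
  ~~ ((T i == [set a; b]) && (T j == [set b; c])) &&
  ~~ ((T i == [set c; d]) && (T j == [set d; a])).
Proof using Tinj trT Tk Q.
case/existsP=> p /existsP[q /existsP[r /and4P[cy /eqP Ti /eqP Tj e]]].
have {e} ne : ~~ eqp r p a c.
  apply: contraTN e => e; have E : [set r; p] = T k by apply/eqP; rewrite Tk set2_eq.
  rewrite negb_or E -(set2_eq r p) in e *; apply/andP; split.
    have : is_diagonal (T k) by apply: (triset_diag trT); apply: imset_f.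
    by case/existsP=> s /existsP[t /and3P[]].
  by apply/existsP => -[l /andP[lk /eqP/Tinj F]]; rewrite F eqxx in lk.
have cy4 := Q.1; apply/andP; split; apply/negP; rewrite Ti Tj !set2_eq;
  by move: cy cy4 ne; rewrite /cyc3 /cyc4 /eqp; clear; lia.
Qed.

End FlipSides.

(** * Flips as seed mutations *)

Section Mutation.
Variable n : nat.
Local Notation vertex := 'I_n.+3.
Implicit Types (T : 'I_n -> {set vertex}) (i j k l : 'I_n).

Definition flipT T k (b d : vertex) : 'I_n -> {set vertex} :=
  fun i => if i == k then [set b; d] else T i.

(* [I1], ..., [I4] (resp. [J1], ..., [J4]): the i-th (resp. j-th) diagonal is
   the side [ab], ..., [da] of the quadrilateral of the flip. *)
Lemma mutation_bits (I1 I2 I3 I4 J1 J2 J3 J4 u v : bool) :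
  let B := Posz (I1 || I3) - Posz (I2 || I4) in
  let C := Posz (J2 || J4) - Posz (J1 || J3) in
  (I1 + I2 + I3 + I4 <= 1)%N -> (J1 + J2 + J3 + J4 <= 1)%N ->
  (u ==> ~~ (J1 && I2) && ~~ (J3 && I4)) && (u ==> ~~ (J2 && I3) && ~~ (J4 && I1)) ->
  (v ==> ~~ (I1 && J2) && ~~ (I3 && J4)) && (v ==> ~~ (I2 && J3) && ~~ (I4 && J1)) ->
  Posz [|| u, J2 && I3 | J4 && I1] - Posz [|| v, I2 && J3 | I4 && J1] =
  (Posz [|| u, J1 && I2 | J3 && I4] - Posz [|| v, I1 && J2 | I3 && J4])
  + (pos_part B)%:Z * (pos_part C)%:Z - (pos_part (- B))%:Z * (pos_part (- C))%:Z.
Proof.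
by case: I1; case: I2; case: I3; case: I4 => // B C _;
  rewrite {}/B {}/C; case: J1; case: J2; case: J3; case: J4; case: u; case: v.
Qed.

Variable x : {set vertex} -> ambient n.

Definition realizes (s : seed n) T : Prop :=
  [/\ injective T, triset (T @: [set: 'I_n]),
      forall j, cluster s j = x (T j) & exchange s = adjacency T].

Lemma prod_side T (p q : vertex) : injective T ->
  (forall p q : vertex, is_side [set p; q] -> x [set p; q] = 1) -> tri_edge T p q ->
  \prod_j x (T j) ^+ (T j == [set p; q]) = x [set p; q].
Proof.
move=> Ti xS; case/orP=> [sd|/imsetP[l _ E]].
  rewrite xS // big1 // => j _; case: eqP => [->|_]; last by rewrite expr0.
  by rewrite xS.
rewrite E (bigD1 l) //= eqxx expr1 big1 ?mulr1 // => j jl.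
by rewrite (inj_eq Ti) (negPf jl) expr0.
Qed.

Section Flip.
Variables (T : 'I_n -> {set vertex}) (k : 'I_n) (a b c d : vertex).
Hypothesis Tinj : injective T.
Hypothesis trT : triset (T @: [set: 'I_n]).
Hypothesis Tk : T k = [set a; c].
Hypothesis Q : quad (T @: [set: 'I_n]) a b c d.
Local Notation T' := (flipT T k b d).

Lemma bd_notin i : T i != [set b; d].
Proof using Tk trT Q.
apply: contraTneq (imset_f T (in_setT i)) => ->.
by apply: quad_diag_notin Q; rewrite // -Tk imset_f.
Qed.

Lemma flipT_inj : injective T'.
Proof using Tinj Tk trT Q.
move=> i j; rewrite /flipT; case: eqP => [->|_]; case: eqP => [->|_] //.
- by move=> E; case/eqP: (bd_notin j).
- by move=> E; case/eqP: (bd_notin i).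
- exact: Tinj.
Qed.

Lemma flipT_set : T' @: [set: 'I_n] = flip (T @: [set: 'I_n]) a b c d.
Proof using Tinj Tk.
apply/setP => e; rewrite in_setU1 in_setD1; apply/imsetP/orP.
  case=> i _ ->; rewrite /flipT; case: (eqVneq i k) => [_|ik]; first by left.
  by right; apply/andP; split; [rewrite -Tk (inj_eq Tinj) | apply: imset_f].
case=> [/eqP->|/andP[ne /imsetP[i _ E]]]; first by exists k; rewrite /flipT ?eqxx.
exists i; rewrite // /flipT ifN //; apply: contraNneq ne => ik.
by rewrite E ik Tk.
Qed.

Lemma flipT_triset : triset (T' @: [set: 'I_n]).
Proof using Tinj Tk trT Q.
by rewrite flipT_set; apply: triset_flip Q; rewrite // -Tk imset_f.
Qed.

Lemma flipT_quad : quad (T' @: [set: 'I_n]) b c d a.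
Proof using Tinj Tk trT Q.
by rewrite flipT_set; apply: flip_quad Q; rewrite // -Tk imset_f.
Qed.

Lemma T_quad_sides i : ((T i == [set a; b]) + (T i == [set b; c]) +
  (T i == [set c; d]) + (T i == [set d; a]) <= 1)%N.
Proof using Q.
have cy := Q.1.
have D (p q r s : vertex) : ~~ eqp p q r s -> ~~ ((T i == [set p; q]) && (T i == [set r; s])).
  by move=> ne; apply: contra ne => /andP[/eqP->]; rewrite set2_eq.
have : [&& ~~ eqp a b b c, ~~ eqp a b c d, ~~ eqp a b d a, ~~ eqp b c c d,
    ~~ eqp b c d a & ~~ eqp c d d a].
  by move: cy; rewrite /eqp /cyc4; clear; lia.
case/and5P=> /D h1 /D h2 /D h3 /D h4 /andP[/D h5 /D h6]; move: h1 h2 h3 h4 h5 h6.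
by do 4!case: (T i == _).
Qed.

Lemma flipT_other i : i != k -> T' i = T i.
Proof. by move=> ik; rewrite /flipT (negPf ik). Qed.

Lemma flipT_away i j : i != k -> j != k ->
  next_away k T' i j = next_away k T i j.
Proof.
move=> ik jk; rewrite /next_away !flipT_other //.
apply: eq_existsb => p; apply: eq_existsb => q; apply: eq_existsb => r.
do 3![congr (_ && _)]; congr (_ || _); apply: eq_existsb => l.
by case: (boolP (l == k)) => //= lk; rewrite flipT_other.
Qed.

(** Only the triangles [abc] and [cda] change, into [bcd] and [dab]. Around the flipped diagonal the
    sides swap roles, which gives the sign change; the other entries reduce to [mutation_bits]. *)
Lemma flip_adjacency i j : adjacency T' i j =
  if (i == k) || (j == k) then - adjacency T i j else
  adjacency T i j
   + (pos_part (adjacency T i k))%:Z * (pos_part (adjacency T k j))%:Z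
   - (pos_part (- adjacency T i k))%:Z * (pos_part (- adjacency T k j))%:Z.
Proof using Tinj Tk trT Q.
have T'k : T' k = [set b; d] by rewrite /flipT eqxx.
have tT' := flipT_triset; have Q' := flipT_quad.
rewrite !adjacencyE; have [-> /=|ik] := eqVneq i k.
  have [->|jk] := eqVneq j k; first by rewrite !subrr oppr0.
  rewrite (next_of_diagonal tT' T'k Q') (next_to_diagonal tT' T'k Q').
  rewrite (next_of_diagonal trT Tk Q) (next_to_diagonal trT Tk Q) flipT_other //.
  by rewrite opprB (orbC (T j == [set c; d])).
have [-> /=|jk] := eqVneq j k.
  rewrite (next_of_diagonal tT' T'k Q') (next_to_diagonal tT' T'k Q').
  rewrite (next_of_diagonal trT Tk Q) (next_to_diagonal trT Tk Q) flipT_other //.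
  by rewrite opprB (orbC (T i == [set c; d])).
rewrite /= !(next_of_diagonal trT Tk Q) !(next_to_diagonal trT Tk Q).
rewrite !(next_awayE tT' T'k Q') !(next_awayE trT Tk Q) !flipT_away //.
rewrite !flipT_other //.
apply: mutation_bits; try exact: T_quad_sides.
  apply/andP; split; apply/implyP; first exact: (next_away_excl Tinj trT Tk Q).
  rewrite -flipT_away // -(flipT_other ik) -(flipT_other jk).
  exact: (next_away_excl flipT_inj tT' T'k Q').
apply/andP; split; apply/implyP; first exact: (next_away_excl Tinj trT Tk Q).
rewrite -flipT_away // -(flipT_other ik) -(flipT_other jk).
exact: (next_away_excl flipT_inj tT' T'k Q').
Qed.

Hypothesis x_side : forall p q : vertex, is_side [set p; q] -> x [set p; q] = 1.
Hypothesis x_neq0 : forall p q : vertex, p != q -> x [set p; q] != 0.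
Hypothesis x_ptolemy : forall a b c d : vertex, cyc4 a b c d ->
  x [set a; c] * x [set b; d] =
  x [set a; b] * x [set c; d] + x [set b; c] * x [set d; a].

Lemma realizes_mutate s : realizes s T -> realizes (mutate s k) T'.
Proof using Tinj Tk trT Q x_side x_neq0 x_ptolemy.
case=> _ _ cl ex; split; [exact: flipT_inj | exact: flipT_triset | |]; last first.
  by rewrite /mutate /= ex; apply/matrixP => i j; rewrite mxE flip_adjacency.
move=> j; rewrite /mutate /= ex /flipT; case: eqP => [_|//]; rewrite !cl Tk.
have [cy [eab ebc ecd eda]] := Q.
have ac : a != c by rewrite -val_eqE; move: cy; rewrite /cyc4 /=; clear; lia.
have excl i := T_quad_sides i.
(* In column [k] the positive entries belong to [ab] and [cd], the negative ones to [bc] and [da];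
   polygon sides contribute the factor 1. *)
have E1 : \prod_i cluster s i ^+ pos_part (adjacency T i k) =
    x [set a; b] * x [set c; d].
  rewrite -(prod_side Tinj x_side eab) -(prod_side Tinj x_side ecd) -big_split /=.
  apply: eq_bigr => i _; rewrite cl adjacencyE.
  rewrite (next_of_diagonal trT Tk Q) (next_to_diagonal trT Tk Q).
  rewrite -exprD; congr (_ ^+ _); move: (excl i).
  by do 4!case: (T i == _).
have E2 : \prod_i cluster s i ^+ pos_part (- adjacency T i k) =
    x [set b; c] * x [set d; a].
  rewrite -(prod_side Tinj x_side ebc) -(prod_side Tinj x_side eda) -big_split /=.
  apply: eq_bigr => i _; rewrite cl adjacencyE.
  rewrite (next_of_diagonal trT Tk Q) (next_to_diagonal trT Tk Q).
  rewrite -exprD; congr (_ ^+ _); move: (excl i).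
  by do 4!case: (T i == _).
by rewrite E1 E2 -x_ptolemy // mulrAC mulfV ?mul1r // x_neq0.
Qed.

End Flip.
End Mutation.

(** * Flip connectivity and the two fans *)

Section FlipConnectivity.
Variable n : nat.
Local Notation vertex := 'I_n.+3.
Implicit Types (D : {set {set vertex}}) (a b c p q v : vertex).

Lemma flipK D (a b c d : vertex) : triset D -> [set a; c] \in D ->
  quad D a b c d -> flip (flip D a b c d) b c d a = D.
Proof.
move=> tD acD Q; have nbd := quad_diag_notin tD acD Q.
apply/setP => e; rewrite /flip (setUC [set c] [set a]).
rewrite !(in_setU1, in_setD1); case: (eqVneq e [set a; c]) => [->|_] /=.
  by rewrite acD.
by case: (eqVneq e [set b; d]) => [->|_] //=; rewrite (negPf nbd).
Qed.

Definition is_star D : Prop := forall v, v != ord0 -> edge D ord0 v.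

(** A diagonal [pq] with [0 < p < q] would cross the edge from 0 to [p.+1] of the star, so all
    diagonals of a star end at 0. *)
Lemma star_unique D D' : triset D -> triset D' -> is_star D -> is_star D' -> D = D'.
Proof.
move=> tD tD' sD sD'; apply: triset_subset_eq => //; apply/subsetP => e eD.
have [p [q [pq E sd]]] := is_diagonalP (triset_diag tD eD).
have ev : edge D p q by rewrite /edge -E eD orbT.
have q0 : q != ord0 by rewrite -val_eqE /=; lia.
suff p0 : p = ord0.
  by have := sD' q q0; rewrite -p0 /edge is_sideE (negPf sd) /= -E.
apply: val_inj => /=; apply/eqP/negPn/negP => p0.
have vn : (p.+1 < n.+3)%N by apply: leq_trans (ltn_ord q); apply: ltnW.
have v0 : Ordinal vn != ord0 by rewrite -val_eqE.
have := edge_nc tD ev (sD _ v0); rewrite /crossn /inarc /=; lia.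
Qed.

Definition degree0 D : nat := #|[set e in D | ord0 \in e]|.

(* The outermost diagonal separating [v] from the vertex [0] is the base of a
   triangle with apex [0], so that flipping it creates a diagonal at [0]. *)
Lemma flip_toward_star D v : triset D -> v != ord0 -> ~~ edge D ord0 v ->
  exists a b c d : vertex, [/\ [set a; c] \in D, quad D a b c d &
    (degree0 D < degree0 (flip D a b c d))%N].
Proof.
move=> tD v0 nv; have v0' : ord0 != v by rewrite eq_sym.
have [w wD Xw] := edge_or_cross tD v0' nv.
pose S := [pred w : vertex * vertex |
  [&& [set w.1; w.2] \in D, (0 < w.1 < v)%N & (v < w.2)%N]].
have [w0 Sw0] : exists w0, S w0.
  move: Xw; rewrite /crossn /inarc /= => X.
  case: (ltnP w.1 w.2) => lt; [exists w | exists (w.2, w.1)]; rewrite /S /=.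
    by rewrite wD; lia.
  by rewrite setUC wD; lia.
case: (arg_maxnP (fun w : vertex * vertex => w.2 - w.1)%N Sw0) => -[p q] /=.
case/and3P=> pqD /andP[p0 pv] vq pqmax.
have [b [d Q]] := diagonal_quad tD pqD; exists p, b, q, d; split=> //.
have [cy [epb ebq eqd edp]] := Q.
have inD (s t : vertex) : edge D s t -> ~~ siden n s t -> [set s; t] \in D.
  by rewrite /edge is_sideE => /orP[->|].
have hb := ltn_ord b; have hd := ltn_ord d; have hq := ltn_ord q.
(* Otherwise [dq] or [pd] would be a longer diagonal separating [v] from 0. *)
have d0 : d = ord0.
  apply: val_inj => /=; apply/eqP/negPn/negP => d0.
  have [dp|qd] : (d < p)%N \/ (q < d)%N by move: cy; rewrite /cyc4; clear -pv vq; lia.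
    have := pqmax (d, q); rewrite /S /= setUC inD //; last first.
      by rewrite /siden; clear -dp pv vq d0; lia.
    by clear -d0 dp pv vq; lia.
  have := pqmax (p, d); rewrite /S /= setUC inD //; last first.
    by rewrite /siden; clear -qd pv vq p0; lia.
  by clear -p0 qd pv vq; lia.
have b0 : b != ord0 by rewrite -d0 -val_eqE /=; move: cy; rewrite /cyc4; clear; lia.
apply: proper_card; apply/properP; split.
  apply/subsetP => e; rewrite in_set => /andP[eD e0].
  rewrite in_set e0 andbT in_setU1 in_setD1 eD andbT; apply/orP; right.
  apply: contraTneq e0 => ->; rewrite !inE.
  by rewrite -!val_eqE /=; clear -p0 pv vq; lia.
exists [set b; d]; first by rewrite in_set in_setU1 eqxx d0 in_set2 eqxx orbT.
by rewrite in_set (negPf (quad_diag_notin tD pqD Q)).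
Qed.

(** Flips raising the degree of the vertex 0 end at the unique star. Flips are reversible by
    [flipK], so [Pr] passes from [D] to the star and from there to [D']. *)
Lemma flip_invariant (Pr : {set {set vertex}} -> Prop) :
  (forall D (a b c d : vertex), triset D -> [set a; c] \in D -> quad D a b c d ->
     Pr D -> Pr (flip D a b c d)) ->
  forall D D', triset D -> triset D' -> Pr D -> Pr D'.
Proof.
move=> H D D' tD tD' PD.
have star E : triset E -> exists E', [/\ triset E', is_star E' & Pr E <-> Pr E'].
  have [m] := ubnP (n - degree0 E)%N; elim: m E => // m IH E lt tE.
  have [sE|nsE] := pselect (is_star E); first by exists E.
  have [v v0 nv] : exists2 v, v != ord0 & ~~ edge E ord0 v.
    apply: contrapT => K; apply: nsE => v v0; apply/negPn/negP => nv; apply: K.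
    by exists v.
  have [a [b [c [d [acE Q lt']]]]] := flip_toward_star tE v0 nv.
  have tF := triset_flip tE acE Q; have [|E' [tE' sE' PE']] := IH _ _ tF.
    have : (degree0 (flip E a b c d) <= n)%N.
      case/andP: tF => _ /eqP F; rewrite -[leqRHS]F; apply: subset_leq_card.
      by apply/subsetP => e; rewrite in_set => /andP[].
    by move: lt lt'; clear; lia.
  exists E'; split=> //; apply: iff_trans PE'; split; first exact: H.
  move=> PF; rewrite -(flipK tE acE Q); apply: H => //.
    by rewrite in_setU1 eqxx.
  exact: flip_quad.
have [E [tE sE PE]] := star D tD; have [E' [tE' sE' PE']] := star D' tD'.
by apply/PE'; rewrite (star_unique tE' tE sE' sE); apply/PE.
Qed.

End FlipConnectivity.

(** * Identification of both fans with the cones of crossing vectors *)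

Section Fans.
Variables (R : realType) (n : nat).
Local Notation vertex := 'I_n.+3.
Variable T : 'I_n -> {set vertex}.
Hypothesis Tinj : injective T.
Hypothesis trT : triset (T @: [set: 'I_n]).

Lemma santos_fanE (P : vertex -> 'rV[R]_2) : convex_polygon P ->
  santos_fan P T = subcones (svec R T) (@triset n).
Proof using Tinj trT.
move=> hP.
have coneE (T' : 'I_n -> {set vertex}) : triangulation P T' ->
    cone (fun j => santos_vector P T (T' j)) predT =
    subcone (svec R T) (T' @: [set: 'I_n]).
  case/(triangulationP hP)=> T'inj tT'.
  rewrite /subcone -(cone_predT (svec R T) T'inj); congr (cone _ _).
  apply/funext => j; rewrite (santos_vectorE hP) //.
  by apply: (triset_diag tT'); apply: imset_f.
apply/seteqP; split=> [C [T' [tT']]|C [D [S [tD SD ->]]]].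
  rewrite coneE //; have [_ tT''] := (triangulationP hP _).1 tT'.
  case/(subcone_face (@svec_dual R n T Tinj trT) tT'' (subxx _))=> S SD ->.
  by exists (T' @: [set: 'I_n]), S.
have cD : #|D| = n by case/andP: tD => _ /eqP.
pose T' (j : 'I_n) : {set vertex} := enum_val (cast_ord (esym cD) j).
have T'D : T' @: [set: 'I_n] = D.
  apply/setP => e; apply/imsetP/idP => [[j _ ->]|eD]; first exact: enum_valP.
  exists (cast_ord cD (enum_rank_in eD e)) => //.
  by rewrite /T' cast_ordK enum_rankK_in.
have tT' : triangulation P T'.
  by apply/(triangulationP hP); rewrite T'D; split=> // i j /enum_val_inj/cast_ord_inj.
exists T'; split=> //; rewrite coneE // T'D.
by apply/(subcone_face (@svec_dual R n T Tinj trT) tD (subxx _)); exists S.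
Qed.

Variable x : {set vertex} -> ambient n.
Hypothesis xP : chord_vars T x.

Lemma realizes_step ks T' k (a b c d : vertex) : realizes x (seed_at T ks) T' ->
  T' k = [set a; c] -> quad (T' @: [set: 'I_n]) a b c d ->
  realizes x (seed_at T (rcons ks k)) (flipT T' k b d).
Proof using Tinj trT xP.
move=> r T'k Q; have [T'inj tT' _ _] := r; have [_ xS xPt] := xP.
rewrite /seed_at foldl_rcons; apply: (realizes_mutate T'inj tT' T'k Q) => //.
by move=> p q; apply: (chord_var_neq0 Tinj trT xP k).
Qed.

Lemma realizes_nil : realizes x (seed_at T [::]) T.
Proof using Tinj trT xP. by have [xT _ _] := xP; split=> // j; rewrite xT. Qed.

Lemma seed_realizes ks : exists T', realizes x (seed_at T ks) T'.
Proof using Tinj trT xP.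
elim/last_ind: ks => [|ks k [T' r]]; first by exists T; apply: realizes_nil.
have [T'inj tT' _ _] := r; have [a [c [_ E]]] := chord_ends tT' k.
have [b [d Q]] : exists b d : vertex, quad (T' @: [set: 'I_n]) a b c d.
  by apply: diagonal_quad tT' _; rewrite -E imset_f.
by exists (flipT T' k b d); apply: realizes_step r E Q.
Qed.

(** Being realized by a seed is preserved by flips, since the flip of the k-th diagonal is the
    mutation at [k]. *)
Lemma triset_reachable D : triset D ->
  exists ks T', realizes x (seed_at T ks) T' /\ T' @: [set: 'I_n] = D.
Proof using Tinj trT xP.
move: D; pose Pr D := exists ks T', realizes x (seed_at T ks) T' /\ T' @: [set: 'I_n] = D.
suff H D : triset D -> Pr D by [].
move=> tD; apply: (flip_invariant (Pr := Pr) _ trT tD); last first.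
  by exists [::], T; split=> //; apply: realizes_nil.
move=> E a b c d tE acE Q [ks [T' [r T'E]]]; move: acE; rewrite -T'E.
case/imsetP=> k _ Tk; exists (rcons ks k), (flipT T' k b d); split.
  by apply: realizes_step r (esym Tk) _; rewrite T'E.
by have [T'inj _ _ _] := r; rewrite (flipT_set b d T'inj (esym Tk)) T'E.
Qed.

Lemma denominator_fanE : denominator_fan R T = subcones (svec R T) (@triset n).
Proof using Tinj trT xP.
have laurent T' j : triset (T' @: [set: 'I_n]) -> pos_laurent (x (T' j)) (chi T (T' j)).
  move=> tT'; have [p [q [pq E]]] := chord_ends tT' j.
  by rewrite E; apply: chord_var_laurent => //; rewrite -val_eqE /=; lia.
apply/seteqP; split=> [C [ks [d [S [dE ->]]]]|C [D [S [tD SD ->]]]].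
  have [T' [T'inj tT' cl _]] := seed_realizes ks.
  exists (T' @: [set: 'I_n]), (T' @: [set j | S j]); split=> //.
    by apply: imsetS; apply/subsetP => j; rewrite in_setT.
  rewrite /subcone -(cone_imset (svec R T) T'inj).
  (* Denominator vectors are unique, so the given [d j] is the crossing vector of [T' j]. *)
  have -> : (fun j => \row_i (d j i)%:~R) = (fun j => svec R T (T' j)).
    apply/funext => j; apply/rowP => i; rewrite !mxE; congr (_%:~R).
    by apply/esym; apply: denominator_unique (laurent T' j tT') _ i; rewrite -cl.
  by congr (cone _ _); apply/funext => j; rewrite in_set.
have [ks [T' [[T'inj tT' cl _] T'D]]] := triset_reachable tD.
exists ks, (fun j => chi T (T' j)), (fun j => T' j \in S); split.
  by move=> j; rewrite cl; apply/pos_laurent_denominator/laurent.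
have SE : S = T' @: [set j | T' j \in S].
  apply/setP => e; apply/idP/imsetP => [eS|[j + ->]]; last by rewrite in_set.
  have := subsetP SD e eS; rewrite -T'D => /imsetP[j _ E].
  by exists j => //; rewrite in_set -E.
rewrite /subcone [in LHS]SE -(cone_imset (svec R T) T'inj); congr (cone _ _).
by apply/funext => j; rewrite in_set.
Qed.

End Fans.

Theorem proposition5p12 (R : realType) (n : nat)
    (P : 'I_n.+3 -> 'rV[R]_2) (hP : convex_polygon P)
    (T : 'I_n -> {set 'I_n.+3}) (hT : triangulation P T) :
  complete_simplicial_fan (denominator_fan R T) /\
  (exists Q : set 'rV[R]_n, santos_associahedron P T Q) /\
  (forall Q : set 'rV[R]_n, santos_associahedron P T Q ->
     is_polytope Q /\ normal_fan Q = denominator_fan R T).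
Proof.
have [Tinj trT] := (triangulationP hP T).1 hT.
have [x xP] := chord_vars_exist Tinj trT.
rewrite (denominator_fanE R Tinj trT xP) /santos_associahedron.
rewrite (santos_fanE Tinj trT hP).
by have [fan [Q HQ]] := svec_fan R Tinj trT; split=> //; split=> //; exists Q.
Qed.
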